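(* Let $(A,\varphi,\phi_{A},[\cdot,\cdot]_{A},a_{A})$ be a Hom-Lie algebroid over $M$ and $(\pi,N)$ a Hom-Poisson-Nijenhuis structure on $A$. Set $\pi_0:=\pi$ and define $2$-sections $\pi_{k+1}\in\Gamma(\Lambda^2A)$ inductively by the condition $\pi_{k+1}^\sharp=N\circ\pi_k^\sharp$. Then all pairs $(\pi_k,N^p)$ ($k,p\geq0$) are Hom-Poisson-Nijenhuis structures on $A$. Furthermore, for any $k,l\geq0$, $[\pi_k,\pi_l]_{A}=0$ (Hom-Schouten bracket).
   Context: All Hom-Lie algebroids are assumed to have an invertible underlying Hom-bundle. Thus a Hom-Lie algebroid $(A,\varphi,\phi_A,[\cdot,\cdot]_A,a_A)$ over a manifold $M$ consists of: a vector bundle $A\to M$; a diffeomorphism $\varphi:M\to M$ (with $\varphi^{*}f:=f\circ\varphi$); an invertible linear map $\phi_A:\Gamma(A)\to\Gamma(A)$ with $\phi_A(fX)=\varphi^*f\cdot\phi_A(X)$; a skew-symmetric $\mathbb R$-bilinear bracket $[\cdot,\cdot]_A$ on $\Gamma(A)$ with $\phi_A[X,Y]_A=[\phi_A(X),\phi_A(Y)]_A$ and the Hom-Jacobi identity $[\phi_A(X),[Y,Z]_A]_A+[\phi_A(Y),[Z,X]_A]_A+[\phi_A(Z),[X,Y]_A]_A=0$; and a bundle map $a_A:A\to\varphi^{!}TM$ (pull-back bundle), where a section $V$ of $\varphi^!TM$ acts on functions by $(V(f))(p)=\langle(df)_{\varphi(p)},V_p\rangle$; such that $[X,fY]_A=\varphi^*f[X,Y]_A+a_A(\phi_A(X))(f)\phi_A(Y)$,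 $a_A(\phi_A(X))\circ\varphi^*=\varphi^*\circ a_A(X)$ and $a_A([X,Y]_A)\circ\varphi^*=a_A(\phi_A(X))\circ a_A(Y)-a_A(\phi_A(Y))\circ a_A(X)$. $\phi_A^\dagger$ on $\Gamma(A^* )$: $\langle\phi_A^\dagger(\xi),X\rangle:=\varphi^*\langle\xi,\phi_A^{-1}(X)\rangle$. $\phi_A$ extends to $\Gamma(\Lambda^\bullet A)$ multiplicatively, with $\phi_A(f)=\varphi^*f$ on functions. Hom-Schouten bracket: the unique bilinear extension $[\cdot,\cdot]_A:\Gamma(\Lambda^kA)\times\Gamma(\Lambda^lA)\to\Gamma(\Lambda^{k+l-1}A)$ of the bracket on $\Gamma(A)$ with $[f,g]_A=0$, $[X,f]_A=a_A(\phi_A(X))(f)$, $[D_1,D_2\wedge D_3]_A=[D_1,D_2]_A\wedge\phi_A(D_3)+(-1)^{(k+1)l}\phi_A(D_2)\wedge[D_1,D_3]_A$, $[D_1,D_2]_A=-(-1)^{(k-1)(l-1)}[D_2,D_1]_A$ ($D_1$ of degree $k$, $D_2$ of degree $l$). For $\pi\in\Gamma(\Lambda^2A)$, $\pi^\sharp:A^*\to A$ is given by $\langle\pi^\sharp\alpha,\beta\rangle=\pi(\alpha,\beta)$. $\pi$ is a Hom-Poisson structure on $A$ if $[\pi,\pi]_A=0$ and $\phi_A(\pi)=\pi$. For a bundle map $N:A\to A$ over $M$, viewed as a section $N=\sum_i\xi^i\otimes X_i$ of $A^*\otimes A$, set $\phi_A(N):=\sum_i\phi_A^\dagger(\xi^i)\otimes\phi_A(X_i)$;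 $N^*:A^*\to A^*$ is the dual map. $\mathcal T_N(X,Y):=[NX,NY]_A-N[NX,Y]_A-N[X,NY]_A+N^2[X,Y]_A$. $N$ is a Hom-Nijenhuis structure on $A$ if $\mathcal T_N=0$ and $\phi_A(N)=N$. For $f\in C^\infty(M)$, $\langle d_Af,X\rangle=a_A(X)(f)$. For $X\in\Gamma(A)$, $\alpha\in\Gamma(A^* )$: $\langle\mathcal L_X^A\alpha,Y\rangle=a_A(\phi_A(X))\langle\alpha,\phi_A^{-1}(Y)\rangle-\langle\phi_A^\dagger(\alpha),[X,\phi_A^{-1}(Y)]_A\rangle$. For $\alpha,\beta\in\Gamma(A^* )$ set $$[\alpha,\beta]_\pi:=\mathcal L^A_{\pi^\sharp\alpha}\beta-\mathcal L^A_{\pi^\sharp\beta}\alpha-d_A\langle\pi^\sharp\alpha,\beta\rangle,$$ $$[\alpha,\beta]_{N\pi^\sharp}:=\mathcal L^A_{N\pi^\sharp\alpha}\beta-\mathcal L^A_{N\pi^\sharp\beta}\alpha-d_A\langle N\pi^\sharp\alpha,\beta\rangle,$$ $$[\alpha,\beta]_\pi^{N^*}:=[N^*\alpha,\beta]_\pi+[\alpha,N^*\beta]_\pi-N^*[\alpha,\beta]_\pi.$$ A Hom-Poisson structure $\pi$ on $A$ and a Hom-Nijenhuis structure $N$ on $A$ are compatible if $N\circ\pi^\sharp=\pi^\sharp\circ N^*$ and $C_\pi^N(\alpha,\beta):=[\alpha,\beta]_{N\pi^\sharp}-[\alpha,\beta]_\pi^{N^*}$ vanishes for all $\alpha,\beta\in\Gamma(A^*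 )$. The pair $(\pi,N)$ is then called a Hom-Poisson-Nijenhuis structure on $A$. $N^p$ is the $p$-fold composition, $N^0=\mathrm{id}_A$. *)

(* Defs.v *)
From HB Require Import structures.
From mathcomp Require Import all_boot all_order all_algebra.
From mathcomp Require Import all_classical all_reals all_analysis.
Set Implicit Arguments.
Unset Strict Implicit.
Unset Printing Implicit Defensive.
Import Order.TTheory GRing.Theory Num.Theory.
Import numFieldNormedType.Exports.
Local Open Scope classical_set_scope.
Local Open Scope ring_scope.

(* Convention: functions, sections and operators on them are total objects on  *)
(* raw (dependent) functions; smoothness is a separate predicate, and every    *)
(* axiom only concerns smooth arguments.                                       *)

(** * Smooth manifolds *)

Fixpoint Ck (R : realType) (n k : nat) (U : set 'rV[R]_n) (f : 'rV[R]_n -> R)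
    : Prop :=
  if k is k'.+1 then
    (forall x, U x -> differentiable f x) /\
    (forall v, Ck k' U (fun x => 'D_v f x))
  else forall x, U x -> {for x, continuous f}.

Definition Cinfty (R : realType) (n : nat) (U : set 'rV[R]_n)
  (f : 'rV[R]_n -> R) : Prop := forall k, Ck k U f.

(* [cinv] is only meaningful on the image of [cdom]. *)
Record chart (R : realType) (n : nat) (T : topologicalType) := Chart {
  cdom : set T;
  cmap : T -> 'rV[R]_n;
  cinv : 'rV[R]_n -> T;
  cdom_open : open cdom;
  cimg_open : open (cmap @` cdom);
  cmap_cont : forall p, cdom p -> {for p, continuous cmap};
  cinv_cont : forall x, (cmap @` cdom) x -> {for x, continuous cinv};
  cmapK : forall p, cdom p -> cinv (cmap p) = p }.

Record manifold (R : realType) (n : nat) := Manifold {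
  mtop :> topologicalType;
  mhausdorff : hausdorff_space mtop;
  msecond_countable : @second_countable mtop;
  atlas : set (chart R n mtop);
  atlas_cover : forall p, exists2 c, atlas c & cdom c p;
  atlas_smooth : forall c d, atlas c -> atlas d -> forall i,
    Cinfty (cmap c @` (cdom c `&` cdom d)) (fun x => cmap d (cinv c x) 0 i) }.

(* Smoothness on an open subset W. *)
Definition smooth_on (R : realType) (n : nat) (M : manifold R n) (W : set M)
    (f : M -> R) : Prop :=
  forall c, atlas c -> Cinfty (cmap c @` (cdom c `&` W)) (f \o cinv c).

Definition smooth (R : realType) (n : nat) (M : manifold R n) (f : M -> R) :=
  smooth_on setT f.

Definition smooth_map (R : realType) (n : nat) (M : manifold R n)
    (h : M -> M) : Prop :=
  continuous h /\
  forall c d, atlas c -> atlas d -> forall i,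
    Cinfty (cmap c @` (cdom c `&` h @^-1` cdom d))
           (fun x => cmap d (h (cinv c x)) 0 i).

(* Tangent vectors at q are the derivations of C^oo(M) at q. *)
Definition tangent_vector (R : realType) (n : nat) (M : manifold R n) (q : M)
    (v : (M -> R) -> R) : Prop :=
  (forall a f g, smooth f -> smooth g ->
     v (fun x => a * f x + g x) = a * v f + v g) /\
  (forall f g, smooth f -> smooth g ->
     v (fun x => f x * g x) = v f * g q + f q * v g).

(** * Vector bundles *)

(* A bundle is given by its fibres together with local frames over an open     *)
(* cover, with smooth transition matrices; the smooth structure of the total   *)
(* space is the one determined by these local trivialisations.                 *)
Record vector_bundle (R : realType) (n : nat) (M : manifold R n) :=
    VectorBundle {
  fibre :> M -> vectType R;
  rank : nat;
  triv : Type;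
  tdom : triv -> set M;
  frame : triv -> forall p : M, rank.-tuple (fibre p);
  tdom_open : forall i, open (tdom i);
  tdom_cover : forall p, exists i, tdom i p;
  frame_basis : forall i p, tdom i p -> basis_of fullv (frame i p);
  frame_smooth : forall i j k l,
    smooth_on (tdom i `&` tdom j)
      (fun p => coord (frame i p) k (tnth (frame j p) l)) }.

Section Bundles.
Context {R : realType} {n : nat} {M : manifold R n}.
Implicit Types A : vector_bundle M.

Definition vfield A := forall p : M, A p.

Definition smooth_section A (X : vfield A) : Prop :=
  forall (i : triv A) j,
    smooth_on (tdom i) (fun p => coord (frame i p) j (X p)).

Definition dual_fibre A (p : M) : vectType R := 'Hom(A p, R^o).

Definition cofield A := forall p : M, dual_fibre A p.

Definition smooth_cosection A (alpha : cofield A) : Prop :=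
  forall (i : triv A) j,
    smooth_on (tdom i) (fun p => alpha p (tnth (frame i p) j)).

Definition pairing A (alpha : cofield A) (X : vfield A) : M -> R :=
  fun p => alpha p (X p).

Definition endofield A := forall p : M, 'End(A p).

Definition bundle_endo A (N : endofield A) : Prop :=
  forall (i : triv A) j k,
    smooth_on (tdom i)
      (fun p => coord (frame i p) k (N p (tnth (frame i p) j))).

Definition endo_app A (N : endofield A) (X : vfield A) : vfield A :=
  fun p => N p (X p).

Definition endo_dual A (N : endofield A) (alpha : cofield A) : cofield A :=
  fun p => (alpha p \o N p)%VF.

Fixpoint endo_pow A (N : endofield A) (k : nat) : endofield A :=
  if k is k'.+1 then fun p => (N p \o endo_pow N k' p)%VF else fun p => \1%VF.

(** * Multisections *)

(* Elements of Lambda^k (A_p) are alternating k-linear forms on the dual fibre;*)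
(* such a form is encoded as a function on lists of covectors that vanishes on *)
(* lists of length other than k.                                               *)
Definition mfield A := forall p : M, seq (dual_fibre A p) -> R.

Definition coframe A (i : triv A) (p : M) (j : 'I_(rank A)) : dual_fibre A p :=
  linfun (coord (frame i p) j).

Definition multisection A (k : nat) (D : mfield A) : Prop :=
  [/\ forall p s, size s != k -> D p s = 0,
      forall p s1 s2 a (xi eta : dual_fibre A p),
        D p (s1 ++ (a *: xi + eta) :: s2) =
          a * D p (s1 ++ xi :: s2) + D p (s1 ++ eta :: s2),
      forall p (s : seq (dual_fibre A p)), ~~ uniq s -> D p s = 0 &
      forall (i : triv A) (js : seq 'I_(rank A)),
        smooth_on (tdom i) (fun p => D p [seq coframe i p j | j <- js])].

Definition mnull A : mfield A := fun p s => 0.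

Definition madd A (D1 D2 : mfield A) : mfield A :=
  fun p s => D1 p s + D2 p s.

Definition mscale A (a : R) (D : mfield A) : mfield A := fun p s => a * D p s.

Definition mfun A (f : M -> R) : mfield A :=
  fun p s => if s is [::] then f p else 0.

Definition mvec A (X : vfield A) : mfield A :=
  fun p s => if s is [:: xi] then xi (X p) else 0.

(* The number of inversions of the shuffle that moves the positions selected   *)
(* by the mask m in front of the other ones.                                   *)
Definition shuffle_inv (k : nat) (m : k.-tuple bool) : nat :=
  \sum_(i < k) \sum_(j < k) ((i < j)%N && ~~ tnth m i && tnth m j).

Definition mwedge A (D1 D2 : mfield A) : mfield A := fun p s =>
  \sum_(m : (size s).-tuple bool)
    (-1) ^+ shuffle_inv m * D1 p (mask m s) * D2 p (mask (map negb m) s).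

(* pi^sharp : A^* -> A, expressed in a basis of the fibre; see [sharpE]. *)
Definition sharp A (D : mfield A) (p : M) (xi : dual_fibre A p) : A p :=
  let b := vbasis (fullv : {vspace A p}) in
  \sum_i D p [:: xi; linfun (coord b i)] *: tnth b i.

Lemma sharpE A (D : mfield A) p (xi eta : dual_fibre A p) :
  multisection 2 D -> eta (sharp D xi) = D p [:: xi; eta].
Proof.
case=> _ Dlin _ _; rewrite /sharp linear_sum /=.
set b := vbasis _.
have Dz : D p [:: xi; 0] = 0.
  have := Dlin p [:: xi] [::] (-1) (0 : dual_fibre A p) (0 : dual_fibre A p).
  by rewrite /= scaler0 addr0 mulN1r addNr.
have Dsum (I : Type) (r : seq I) (c : I -> R) (F : I -> dual_fibre A p) :
    D p [:: xi; \sum_(i <- r) c i *: F i] =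
    \sum_(i <- r) c i * D p [:: xi; F i].
  elim: r => [|i r IH]; first by rewrite !big_nil.
  by rewrite !big_cons (Dlin p [:: xi] [::]) /= IH.
have -> : eta = \sum_(i < _) eta (tnth b i) *: linfun (coord b i).
  apply/lfunP => v; rewrite sum_lfunE.
  rewrite {1}(coord_basis (vbasisP fullv) (memvf v)) linear_sum /=.
  apply: eq_bigr => i _.
  by rewrite linearZ scale_lfunE lfunE /= /GRing.scale /= mulrC (tnth_nth 0).
rewrite Dsum; apply: eq_bigr => i _.
rewrite linearZ /= sum_lfunE /GRing.scale /=.
rewrite (bigD1 i) //= scale_lfunE lfunE /= (tnth_nth 0).
rewrite coord_free ?(basis_free (vbasisP _)) // eqxx.
rewrite big1 ?addr0; last first.
  move=> j ji; rewrite scale_lfunE lfunE /=.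
  rewrite coord_free ?(basis_free (vbasisP _)) //.
  by rewrite /GRing.scale /= eq_sym (negbTE ji) mulr0.
by rewrite /GRing.scale /= mulr1 mulrC.
Qed.

(** * Hom-Lie algebroids *)

(* [anchor : A_p -> T_(phi p) M] is the bundle map A -> phi^! TM. *)
Record hom_lie_algebroid A := HomLieAlgebroid {
  bphi : M -> M;
  bphi_inv : M -> M;
  bphiK : cancel bphi bphi_inv;
  bphi_invK : cancel bphi_inv bphi;
  bphi_smooth : smooth_map bphi;
  bphi_inv_smooth : smooth_map bphi_inv;

  phiA : vfield A -> vfield A;
  phiA_inv : vfield A -> vfield A;
  phiA_section : forall X, smooth_section X -> smooth_section (phiA X);
  phiA_inv_section : forall X, smooth_section X -> smooth_section (phiA_inv X);
  phiAK : forall X, smooth_section X -> phiA_inv (phiA X) = X;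
  phiA_invK : forall X, smooth_section X -> phiA (phiA_inv X) = X;
  phiA_linear : forall a X Y p, smooth_section X -> smooth_section Y ->
    phiA (fun q => a *: X q + Y q) p = a *: phiA X p + phiA Y p;
  phiA_scale : forall f X p, smooth f -> smooth_section X ->
    phiA (fun q => f q *: X q) p = f (bphi p) *: phiA X p;

  anchor : forall p, A p -> (M -> R) -> R;
  anchor_tangent : forall p (u : A p), tangent_vector (bphi p) (anchor u);
  anchor_linear : forall p a (u v : A p) f, smooth f ->
    anchor (a *: u + v) f = a * anchor u f + anchor v f;
  anchor_smooth : forall (i : triv A) j f, smooth f ->
    smooth_on (tdom i) (fun p => anchor (tnth (frame i p) j) f);

  bracket : vfield A -> vfield A -> vfield A;
  bracket_section : forall X Y, smooth_section X -> smooth_section Y ->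
    smooth_section (bracket X Y);
  bracket_skew : forall X Y p, smooth_section X -> smooth_section Y ->
    bracket X Y p = - bracket Y X p;
  bracket_linear : forall a X Y Z p,
    smooth_section X -> smooth_section Y -> smooth_section Z ->
    bracket (fun q => a *: X q + Y q) Z p = a *: bracket X Z p + bracket Y Z p;
  phiA_bracket : forall X Y, smooth_section X -> smooth_section Y ->
    phiA (bracket X Y) = bracket (phiA X) (phiA Y);
  hom_jacobi : forall X Y Z p,
    smooth_section X -> smooth_section Y -> smooth_section Z ->
    bracket (phiA X) (bracket Y Z) p + bracket (phiA Y) (bracket Z X) p +
    bracket (phiA Z) (bracket X Y) p = 0;
  bracket_leibniz : forall X f Y p,
    smooth_section X -> smooth f -> smooth_section Y ->
    bracket X (fun q => f q *: Y q) p =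
      f (bphi p) *: bracket X Y p + anchor (phiA X p) f *: phiA Y p;
  anchor_phiA : forall X f p, smooth_section X -> smooth f ->
    anchor (phiA X p) (f \o bphi) = anchor (X (bphi p)) f;
  anchor_bracket : forall X Y f p,
    smooth_section X -> smooth_section Y -> smooth f ->
    anchor (bracket X Y p) (f \o bphi) =
      anchor (phiA X p) (fun q => anchor (Y q) f) -
      anchor (phiA Y p) (fun q => anchor (X q) f) }.

Section Calculus.
Context {A : vector_bundle M}.
Variable H : hom_lie_algebroid A.
Local Notation phi := (bphi H).
Local Notation phi_A := (phiA H).
Local Notation phi_A_inv := (phiA_inv H).
Local Notation "[[ X , Y ]]" := (bracket H X Y).

(* Sections of A^* built below are given by their pairing with sections Y of A;*)
(* thus N^* of such a section is its precomposition with endo_app N.           *)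

Definition act (X : vfield A) (f : M -> R) : M -> R :=
  fun p => anchor H (X p) f.

Definition dA (f : M -> R) (X : vfield A) : M -> R := act X f.

Definition phi_dag (xi : cofield A) (X : vfield A) : M -> R :=
  pairing xi (phi_A_inv X) \o phi.

Definition lie (X : vfield A) (alpha : cofield A) (Y : vfield A) : M -> R :=
  fun p => act (phi_A X) (pairing alpha (phi_A_inv Y)) p
           - phi_dag alpha [[X, phi_A_inv Y]] p.

(* [alpha, beta]_P for a bundle map P : A^* -> A. *)
Definition cobracket (P : forall p, dual_fibre A p -> A p)
    (alpha beta : cofield A) (Y : vfield A) : M -> R :=
  let P' (gamma : cofield A) : vfield A := fun p => P p (gamma p) in
  fun p => lie (P' alpha) beta Y p - lie (P' beta) alpha Y p
           - dA (pairing beta (P' alpha)) Y p.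

(* The multiplicative extension of phi_A to the sections of Lambda A, given by *)
(* its characterisation on smooth sections.                                    *)
Record phi_extension (Phi : mfield A -> mfield A) : Prop := {
  phi_ext_multisection : forall k D, multisection k D ->
    multisection k (Phi D);
  phi_ext_linear : forall k a D1 D2,
    multisection k D1 -> multisection k D2 ->
    Phi (madd (mscale a D1) D2) = madd (mscale a (Phi D1)) (Phi D2);
  phi_ext_fun : forall f, smooth f -> Phi (mfun f) = mfun (f \o phi);
  phi_ext_vec : forall X, smooth_section X -> Phi (mvec X) = mvec (phi_A X);
  phi_ext_wedge : forall k l D1 D2, multisection k D1 -> multisection l D2 ->
    Phi (mwedge D1 D2) = mwedge (Phi D1) (Phi D2) }.

(* The Hom-Schouten bracket. For k = l = 0 its value, of degree -1, is zero.   *)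
(* The sign exponents (k-1)(l-1) are replaced by (k+1)(l+1), which has the     *)
(* same parity and is a natural number for k = 0 or l = 0 as well.             *)
Record hom_schouten (Phi : mfield A -> mfield A)
    (S : mfield A -> mfield A -> mfield A) : Prop := {
  schouten_multisection : forall k l D1 D2,
    multisection k D1 -> multisection l D2 ->
    multisection (k + l).-1 (S D1 D2);
  schouten_linearl : forall k l a D1 D1' D2,
    multisection k D1 -> multisection k D1' -> multisection l D2 ->
    S (madd (mscale a D1) D1') D2 = madd (mscale a (S D1 D2)) (S D1' D2);
  schouten_linearr : forall k l a D1 D2 D2',
    multisection k D1 -> multisection l D2 -> multisection l D2' ->
    S D1 (madd (mscale a D2) D2') = madd (mscale a (S D1 D2)) (S D1 D2');
  schouten_vec : forall X Y, smooth_section X -> smooth_section Y ->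
    S (mvec X) (mvec Y) = mvec [[X, Y]];
  schouten_fun : forall f g, smooth f -> smooth g ->
    S (mfun f) (mfun g) = mnull (A := A);
  schouten_vec_fun : forall X f, smooth_section X -> smooth f ->
    S (mvec X) (mfun f) = mfun (act (phi_A X) f);
  schouten_leibniz : forall k l m D1 D2 D3,
    multisection k D1 -> multisection l D2 -> multisection m D3 ->
    S D1 (mwedge D2 D3) =
      madd (mwedge (S D1 D2) (Phi D3))
           (mscale ((-1) ^+ (k.+1 * l)) (mwedge (Phi D2) (S D1 D3)));
  schouten_skew : forall k l D1 D2, multisection k D1 -> multisection l D2 ->
    S D1 D2 = mscale (- (-1) ^+ (k.+1 * l.+1)) (S D2 D1) }.

(* N' = phi_A(N). A section of A^* (x) A is a finite sum of xi_i (x) X_i, and  *)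
(* the value at p of phi_A^dag(xi) (x) phi_A(X) only involves xi (x) X at      *)
(* phi(p); hence it is enough, at p, to decompose N at phi(p).                 *)
Definition phi_endo (N N' : endofield A) : Prop :=
  forall p m (xi : 'I_m -> cofield A) (X : 'I_m -> vfield A),
    (forall i, smooth_cosection (xi i)) -> (forall i, smooth_section (X i)) ->
    (forall v, N (phi p) v = \sum_i xi i (phi p) v *: X i (phi p)) ->
    forall Y, smooth_section Y ->
      N' p (Y p) = \sum_i phi_dag (xi i) Y p *: phi_A (X i) p.

Definition torsion (N : endofield A) (X Y : vfield A) : vfield A :=
  let NX := endo_app N X in let NY := endo_app N Y in
  fun p => [[NX, NY]] p - N p ([[NX, Y]] p) - N p ([[X, NY]] p)
           + endo_pow N 2 p ([[X, Y]] p).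

Record hom_nijenhuis (N : endofield A) : Prop := {
  nijenhuis_bundle : bundle_endo N;
  nijenhuis_torsion : forall X Y p, smooth_section X -> smooth_section Y ->
    torsion N X Y p = 0;
  nijenhuis_phi : phi_endo N N }.

Definition compatible (pi : mfield A) (N : endofield A) : Prop :=
  (forall p (xi : dual_fibre A p),
     N p (sharp pi xi) = sharp pi (xi \o N p)%VF) /\
  (forall alpha beta Y p,
     smooth_cosection alpha -> smooth_cosection beta -> smooth_section Y ->
     cobracket (fun q xi => N q (sharp pi xi)) alpha beta Y p =
       cobracket (fun q => @sharp A pi q) (endo_dual N alpha) beta Y p
       + cobracket (fun q => @sharp A pi q) alpha (endo_dual N beta) Y p
       - cobracket (fun q => @sharp A pi q) alpha beta (endo_app N Y) p).

Record hom_poisson (Phi : mfield A -> mfield A)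
    (S : mfield A -> mfield A -> mfield A) (pi : mfield A) : Prop := {
  poisson_multisection : multisection 2 pi;
  poisson_schouten : S pi pi = mnull (A := A);
  poisson_phi : Phi pi = pi }.

Record hom_poisson_nijenhuis (Phi : mfield A -> mfield A)
    (S : mfield A -> mfield A -> mfield A) (pi : mfield A)
    (N : endofield A) : Prop := {
  pn_poisson : hom_poisson Phi S pi;
  pn_nijenhuis : hom_nijenhuis N;
  pn_compatible : compatible pi N }.

End Calculus.

Definition pn_hierarchy A (pi : mfield A) (N : endofield A)
    (pis : nat -> mfield A) : Prop :=
  [/\ pis 0 = pi,
      forall k, multisection 2 (pis k) &
      forall k p (xi : dual_fibre A p),
        sharp (pis k.+1) xi = N p (sharp (pis k) xi)].

End Bundles.

(* Main.v *)
From HB Require Import structures.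
Require Import Defs.
From mathcomp Require Import all_boot all_order all_algebra.
From mathcomp Require Import all_classical all_reals all_analysis.
From mathcomp Require Import ring lra.
Set Implicit Arguments.
Unset Strict Implicit.
Unset Printing Implicit Defensive.
Import Order.TTheory GRing.Theory Num.Theory.
Import numFieldNormedType.Exports.
Local Open Scope classical_set_scope.
Local Open Scope ring_scope.

(* In measure theory these names denote other notions. *)
Local Notation mfun := Defs.mfun.
Local Notation mscale := Defs.mscale.

(** Since [phi_A] is invertible, the Hom-structure can be untwisted: with
[[X, Y]' = phi_A^-1 [X, Y]] and [rho(X) f = (a (phi_A X) f) o phi^-1] the twisted
Leibniz rules become the ordinary ones ([untwisted_skew_algebroid]).  The
conditions of the theorem become the classical ones for this bracket, together
with invariance under [phi_A], which passes from [N] and [pi] to the powers of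
[N] and to [N^k pi] at once.

For the classical statement, the compatibility of a bivector [P] with [N] is
rewritten as the vanishing of an expression [concomitant P N] that involves no
Lie derivative of a form ([concomitantE]).  In this form it is linear in [P],
and two short identities show that it passes from [(P, N)] to [(N P, N)]
([concomitant_free_post]) and from [N] to the powers of [N]
([concomitant_free_pow]); the only other input is that the Nijenhuis torsion
of [N], also in the mixed form [mixed_torsion], vanishes for all powers
([torsion_free_pow]).  Hence every [N^k pi] is compatible with every [N^p].

A bivector [P] is Poisson when [P [a, b]_P = [P a, P b]'] for all one-forms [a]
and [b].  If [P] is Poisson and compatible with [N], the compatibility expresses
[[a, b]_{N P}] by the bracket of [P], and the Poisson identity for [P] then gives
[[P, N P] = 0] ([schouten3_free_post]) and, by the vanishing of the torsion,
[[N P, N P] = 0] ([schouten3_free_post2]).  With powers of [N] in place of [N]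
this yields [[N^k pi, N^l pi] = 0] for all [k] and [l].

What remains is to evaluate the Hom-Schouten bracket of two bivectors, of which
only the algebraic rules are given: at a point it is the classical trilinear
expression [schouten3] ([schouten_bivector]).  This needs bivectors to be sums
of products of global sections.  A bump function turns a local frame at [q] into
global sections that decompose the identity up to a function which agrees with
the constant [1] at [q] to first order ([local_frame]); all operations involved
are of first order, so that this error is invisible at [q]. *)

(** * Smooth functions on open subsets of a coordinate space *)

Lemma near_eq_differentiable (K : numFieldType) (V W : normedModType K)
    (f g : V -> W) (x : V) :
  (\near x, f x = g x) -> differentiable f x -> differentiable g x.
Proof.
move=> fg df.
have expand_g : g \o shift x = cst (g x) + 'd f x +o_ 0 id.
  move: (diff_locally df) => /eqaddoP expand_f; apply/eqaddoP => e e0.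
  have fg0 : \forall h \near (0 : V), f (h + x) = g (h + x).
    move: fg; rewrite (near_shift 0 x).
    by apply: filterS => y /=; rewrite subr0.
  apply: filterS2 fg0 (expand_f e e0) => y /= fgy.
  rewrite -[(_ - _) y]/(f (y + x) - (f x + 'd f x y)).
  rewrite -[(g \o _ - _) y]/(g (y + x) - (g x + 'd f x y)).
  by rewrite fgy (nbhs_singleton fg).
have dE := diff_unique (diff_continuous df) expand_g.
by apply/diff_locallyP; rewrite dE; split=> //; apply: diff_continuous.
Qed.

Section SmoothFunctions.
Context {R : realType} {n : nat}.
Implicit Types (U V : set 'rV[R]_n) (f g : 'rV[R]_n -> R).

Lemma Ck_sub k U V f : V `<=` U -> Ck k U f -> Ck k V f.
Proof.
move=> VU; elim: k f => [|k IH] f /=; first by move=> Uf x /VU/Uf.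
by case=> df Df; split=> [x /VU/df|v] //; apply: IH.
Qed.

Lemma Ck_local k U f :
  (forall x, U x -> exists2 V, V x & Ck k V f) -> Ck k U f.
Proof.
elim: k f => [|k IH] f /= Uf.
  by move=> x /Uf[V Vx]; exact.
split=> [x /Uf[V Vx [df _]]|v]; first exact: df.
by apply: IH => x /Uf[V Vx [_ Df]]; exists V.
Qed.

Lemma Ck_weaken k U f : Ck k.+1 U f -> Ck k U f.
Proof.
elim: k f => [|k IH] f [df Df] /=.
  by move=> x /df; exact: differentiable_continuous.
by split=> // v; apply: IH.
Qed.

(** Openness of [U] matters: the derivatives at a point of [U] involve the values
on a neighbourhood. *)
Lemma Ck_eq k U f g : open U -> (forall x, U x -> f x = g x) ->
  Ck k U f -> Ck k U g.
Proof.
move=> Uop; elim: k f g => [|k IH] f g fg /=.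
  move=> fc x Ux; have fg_near : \near x, f x = g x.
    by apply: (filterS fg); exact: open_nbhs_nbhs.
  change (g y @[y --> x] --> g x); rewrite -(fg x Ux).
  exact: (cvg_trans (near_eq_cvg fg_near) (fc x Ux)).
have fg_near x : U x -> \near x, f x = g x.
  by move=> Ux; apply: (filterS fg); exact: open_nbhs_nbhs.
case=> df Df; split=> [x Ux|v].
  by apply: near_eq_differentiable (df x Ux); exact: fg_near.
apply: IH (Df v) => x Ux.
by apply: near_eq_derive; exact: fg_near.
Qed.

Lemma Ck_cst k U (a : R) : Ck k U (fun=> a).
Proof.
elim: k a => [|k IH] a; first by move=> x _; exact: cst_continuous.
split=> [x _|v]; first exact: differentiable_cst.
rewrite [X in Ck _ _ X](_ : _ = fun=> 0) //.
by apply/funext => x; rewrite derive_cst.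
Qed.

Lemma CkD k U f g : open U -> Ck k U f -> Ck k U g ->
  Ck k U (fun x => f x + g x).
Proof.
move=> Uop; elim: k f g => [|k IH] f g /=.
  by move=> fc gc x Ux; exact: cvgD (fc x Ux) (gc x Ux).
case=> df Df [dg Dg]; split=> [x Ux|v].
  by apply: differentiableD; [exact: df|exact: dg].
apply: Ck_eq Uop _ (IH _ _ (Df v) (Dg v)) => x Ux.
by rewrite [RHS]deriveD //; apply: diff_derivable; [exact: df|exact: dg].
Qed.

Lemma CkM k U f g : open U -> Ck k U f -> Ck k U g ->
  Ck k U (fun x => f x * g x).
Proof.
move=> Uop; elim: k f g => [|k IH] f g.
  by move=> fc gc x Ux; exact: cvgM (fc x Ux) (gc x Ux).
move=> Cf Cg; have [f' g'] := (Ck_weaken Cf, Ck_weaken Cg).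
case: Cf => df Df; case: Cg => dg Dg; split=> [x Ux|v].
  by apply: differentiableM; [exact: df|exact: dg].
apply: Ck_eq Uop _ (CkD Uop (IH _ _ f' (Dg v)) (IH _ _ g' (Df v))) => x Ux.
by rewrite [RHS]deriveM //; apply: diff_derivable; [exact: df|exact: dg].
Qed.

End SmoothFunctions.

(** * A smooth function on the line that vanishes on the negative half-line *)

Section FlatFunction.
Context {R : realType}.

(** All derivatives of [exp (-1/t)] at [t > 0] are combinations of these
functions, and the recursion [is_derive_flat] between them avoids carrying
polynomials in [1/t] along. *)
Definition flat (n : nat) (t : R) : R :=
  if 0 < t then t^-1 ^+ n * expR (- t^-1) else 0.

Lemma flat_gt0 n t : 0 < t -> 0 < flat n t.
Proof.
by move=> t0; rewrite /flat t0 mulr_gt0 ?expR_gt0 // exprn_gt0 // invr_gt0.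
Qed.

Lemma flat_le0 n t : t <= 0 -> flat n t = 0.
Proof. by rewrite /flat leNgt => /negbTE ->. Qed.

(** From [s ^ (n+2) / (n+2)! <= exp s] at [s = 1/t]. *)
Lemma flat_quadratic n t : `|flat n t| <= n.+2`!%:R * `|t| ^+ 2.
Proof.
have [t0|t0] := ltP 0 t; last first.
  by rewrite flat_le0 // normr0 mulr_ge0 // ?ler0n // exprn_ge0.
rewrite !gtr0_norm ?flat_gt0 // /flat t0.
have s0 : 0 < t^-1 by rewrite invr_gt0.
have : t^-1 ^+ n.+2 / n.+2`!%:R <= expR t^-1.
  by apply: le_trans (expR_ge1Dxn n.+1 (ltW s0)); rewrite lerDr.
rewrite ler_pdivrMr ?ltr0n ?fact_gt0 // => h.
rewrite expRN ler_pdivrMr ?expR_gt0 //.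
have -> : t^-1 ^+ n = t ^+ 2 * t^-1 ^+ n.+2.
  by rewrite -[n.+2]addn2 exprD [_ ^+ n * _]mulrC mulrA -exprMn divff ?gt_eqF //
    expr1n mul1r.
by rewrite -[leRHS]mulrA [leRHS]mulrCA ler_pM2l ?exprn_gt0 // mulrC.
Qed.

Lemma flat_at0 n : flat n t @[t --> (0 : R)] --> (0 : R).
Proof.
apply/cvgr0Pnorm_le => e e0.
have c0 : 0 < n.+2`!%:R :> R by rewrite ltr0n fact_gt0.
near=> t; apply: le_trans (flat_quadratic n t) _.
have t1 : `|t| <= 1.
  by near: t; apply: (@nbhs0_le R R^o).
have te : `|t| <= e / n.+2`!%:R.
  near: t. by apply: (@nbhs0_le R R^o); exact: divr_gt0.
rewrite -ler_pdivlMl // mulrC; apply: le_trans te.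
by rewrite expr2 ler_piMl.
Unshelve. all: by end_near. Qed.

Lemma is_derive_flat n (t : R) :
  is_derive t 1 (flat n) (flat n.+2 t - n%:R * flat n.+1 t).
Proof.
have [t0|t0|t0] := ltrgtP 0 t.
- have tn0 : t != 0 by rewrite gt_eqF.
  apply: (@near_eq_is_derive R R^o R^o (fun u => u^-1 ^+ n * expR (- u^-1))).
    near=> u; rewrite /flat ifT //; near: u; exact: lt_nbhsr.
  apply: is_derive_eq.
    have inv_t : is_derive t 1 (fun u : R => u^-1) (- t ^- 2 *: 1).
      by apply: is_deriveV.
    have powexp : is_derive t^-1 1 (fun v : R => v ^+ n * expR (- v))
       (t^-1 ^+ n *: (expR (- t^-1) * - 1) +
        expR (- t^-1) *: (n%:R *: t^-1 ^+ n.-1 *: 1)).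
      apply: is_deriveM; rewrite -exp_derive.
      exact/derivableP/exprn_derivable.
    exact: (is_derive1_comp powexp inv_t).
  rewrite /flat t0 /GRing.scale /= !mulr1 -[t ^- 2]exprVn.
  by case: n => [|n]; rewrite /= ?exprS; ring.
- apply: (@near_eq_is_derive R R^o R^o (cst 0)).
    near=> u; rewrite /cst flat_le0 // ltW //; near: u; exact: lt_nbhsl.
  by rewrite !flat_le0 ?ltW // mulr0 subr0; exact: is_derive_cst.
(* At [0] the difference quotient of [flat n] is [flat n.+1]. *)
rewrite -t0; apply/is_derive1_caratheodory; exists (flat n.+1).
rewrite !flat_le0 // mulr0 subr0; split=> [z||//].
  rewrite !subr0 /flat.
  case: ifP => [z0|_]; last by rewrite mul0r.
  by rewrite exprS mulrAC [_ * z]mulrC mulrA divff ?mul1r // gt_eqF.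
change (flat n.+1 y @[y --> (0 : R)] --> flat n.+1 0).
by rewrite flat_le0 //; exact: flat_at0.
Unshelve. all: by end_near. Qed.

End FlatFunction.

(** By induction on [k], for all the functions [flat m] at once, since their
derivatives are combinations of functions of the same family. *)
Lemma Ck_flat {R : realType} {n : nat} k m (U : set 'rV[R]_n) q :
  open U -> Cinfty U q -> Ck k U (fun x => flat m (q x)).
Proof.
move=> Uop qs; have [dq _] := qs 1%N.
have dflat j (t : R) : differentiable (flat j) t.
  by apply/derivable1_diffP; have [] := is_derive_flat j t.
have dcomp j x : U x -> differentiable (fun y => flat j (q y)) x.
  by move=> /dq Ux; apply: differentiable_comp.
elim: k m => [|k IH] m.
  move=> x Ux.
  exact: (differentiable_continuous (dcomp m x Ux)).
split=> [x|v]; first exact: dcomp.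
have Dq : Ck k U (fun x => 'D_v q x) by case: (qs k.+1) => _; apply.
have Dflat : Ck k U (fun x =>
    (flat m.+2 (q x) + - m%:R * flat m.+1 (q x)) * 'D_v q x).
  apply: (CkM Uop) => //; apply: (CkD Uop) => //; apply: (CkM Uop) => //.
  exact: Ck_cst.
apply: Ck_eq Uop _ Dflat => x Ux /=.
rewrite (deriveE _ (dcomp m x Ux)) diff_comp //=; last exact: dq.
rewrite deriveE; last exact: dq.
case: (is_derive_flat m (q x)) => _; rewrite deriveE // => flat'.
rewrite mulNr -flat' mulrC.
by rewrite -[X in _ = 'd _ _ X]mulr1 [RHS]linearZ.
Qed.

Section ManifoldFunctions.
Context {R : realType} {n : nat} {M : manifold R n}.
Implicit Types (W : set M) (f g : M -> R).

Lemma chart_img_open (c : chart R n M) W :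
  open W -> open (cmap c @` (cdom c `&` W)).
Proof.
move=> Wop; rewrite openE => _ [p [cp Wp] <-].
have cpx : (cmap c @` cdom c) (cmap c p) by exists p.
have dom_near : nbhs (cmap c p) (cmap c @` cdom c).
  by apply: open_nbhs_nbhs; split=> //; exact: cimg_open.
have inv_near : nbhs (cmap c p) (cinv c @^-1` W).
  apply: (cinv_cont cpx); rewrite /= cmapK //.
  exact: open_nbhs_nbhs.
apply: filterS2 dom_near inv_near => _ [p' cp' <-] /=.
by rewrite cmapK // => Wp'; exists p'.
Qed.

Lemma smooth_on_local W f :
  (forall q, W q -> exists2 W', W' q & smooth_on W' f) -> smooth_on W f.
Proof.
move=> loc c cA k; apply: Ck_local => _ [q [cq Wq] <-].
have [W' Wq' fs] := loc q Wq.
by exists (cmap c @` (cdom c `&` W')); [exists q|exact: fs].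
Qed.

Lemma smooth_on_sub W W' f : W' `<=` W -> smooth_on W f -> smooth_on W' f.
Proof.
move=> sub fs c cA k; apply: Ck_sub (fs c cA k) => _ [q [cq /sub Wq] <-].
by exists q.
Qed.

Lemma smooth_on_eq W f g : open W -> (forall q, W q -> f q = g q) ->
  smooth_on W f -> smooth_on W g.
Proof.
move=> Wop fg fs c cA k; apply: Ck_eq (fs c cA k); first exact: chart_img_open.
by move=> _ [q [cq Wq] <-] /=; rewrite cmapK // fg.
Qed.

Lemma smooth_on_cst W (a : R) : smooth_on W (fun=> a).
Proof. by move=> c cA k; exact: Ck_cst. Qed.

Lemma smooth_onD W f g : open W -> smooth_on W f -> smooth_on W g ->
  smooth_on W (fun q => f q + g q).
Proof.
move=> Wop fs gs c cA k.
by apply: CkD; [exact: chart_img_open|exact: fs|exact: gs].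
Qed.

Lemma smooth_onM W f g : open W -> smooth_on W f -> smooth_on W g ->
  smooth_on W (fun q => f q * g q).
Proof.
move=> Wop fs gs c cA k.
by apply: CkM; [exact: chart_img_open|exact: fs|exact: gs].
Qed.

Lemma smooth_on_sum W m (f : 'I_m -> M -> R) : open W ->
  (forall i, smooth_on W (f i)) -> smooth_on W (fun q => \sum_i f i q).
Proof.
move=> Wop fs; elim: (index_enum _) => [|i r IH].
  by apply: smooth_on_eq (smooth_on_cst W 0) => // q _; rewrite big_nil.
by apply: smooth_on_eq (smooth_onD Wop (fs i) IH) => // q _; rewrite big_cons.
Qed.

Lemma smooth_on_flat m W f : open W -> smooth_on W f ->
  smooth_on W (fun q => flat m (f q)).
Proof.
by move=> Wop fs c cA k; apply: Ck_flat; [exact: chart_img_open|exact: fs].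
Qed.

(** The bump function is read in one chart only; in the other charts it is
smooth because the transition maps are, and near the points outside of the first
chart it is zero because its support is compact, hence closed. *)
Lemma bump_function W (q : M) : open W -> W q ->
  exists g : M -> R, exists K : set M,
    [/\ smooth g, g q = 1, closed K, K `<=` W & forall p, ~ K p -> g p = 0].
Proof.
move=> Wop Wq; have [c cA cq] := atlas_cover q.
pose x0 := cmap c q; pose O := cmap c @` (cdom c `&` W).
have Oop : open O by exact: chart_img_open.
have : nbhs x0 O by apply: open_nbhs_nbhs; split=> //; exists q.
move=> /nbhs_ballP[e /= e0 eO].
pose a := e / 2; have a0 : 0 < a by rewrite divr_gt0.
pose side i := `[x0 0 i - a, x0 0 i + a]%classic.
pose box := [set x : 'rV[R]_n | forall i, side i (x ord0 i)].
have box_compact : compact box.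
  by apply: (@rV_compact _ _ side) => i; exact: segment_compact.
have boxO : box `<=` O.
  move=> x bx; apply: eO; split=> // i j; rewrite ord1 /ball /=.
  have := bx j; rewrite /side /= in_itv /= /a => /andP[h1 h2].
  by rewrite ltr_distlC; apply/andP; split; lra.
pose K := cinv c @` box.
have KW p : K p -> cdom c p /\ W p.
  by move=> [x /boxO[p' [cp' Wp'] <-] <-]; rewrite cmapK.
have K_closed : closed K.
  apply: compact_closed; first exact: mhausdorff.
  apply: continuous_compact box_compact.
  apply: continuous_in_subspaceT => x /set_mem/boxO[p' [cp' _] <-].
  by apply: cinv_cont; exists p'.
pose r2 (x : 'rV[R]_n) :=
  a * a + - 1 * \sum_i (x 0 i + - x0 0 i) * (x 0 i + - x0 0 i).
have r2_box x : 0 < r2 x -> box x.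
  rewrite /r2 mulN1r subr_gt0 => x_lt i; rewrite /side /= in_itv /=.
  have : (x 0 i + - x0 0 i) * (x 0 i + - x0 0 i) < a * a.
    apply: le_lt_trans x_lt; rewrite (bigD1 i) //= lerDl.
    by apply: sumr_ge0 => j _; rewrite -expr2 sqr_ge0.
  move=> sq_lt; apply/andP; split; nra.
have r2_q : r2 x0 = a * a.
  by rewrite /r2 big1 ?mulr0 ?addr0 // => i _; rewrite subrr mul0r.
pose c0 := flat 0 (a * a).
have c0_gt0 : 0 < c0 by apply: flat_gt0; exact: mulr_gt0.
pose g p := if pselect (cdom c p) then c0^-1 * flat 0 (r2 (cmap c p)) else 0.
have gE p : cdom c p -> g p = c0^-1 * flat 0 (r2 (cmap c p)).
  by rewrite /g; case: pselect.
have gK p : ~ K p -> g p = 0.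
  rewrite /g; case: pselect => // cp nK; rewrite flat_le0 ?mulr0 // leNgt.
  by apply/negP => /r2_box bx; apply: nK; exists (cmap c p); rewrite ?cmapK.
exists g, K; split=> //; last first.
- by move=> p /KW[].
- by rewrite gE // -/x0 r2_q mulVf // gt_eqF.
apply: smooth_on_local => p _; have [cp|ncp] := pselect (cdom c p).
  have cop : open (cdom c) by exact: cdom_open.
  have coord_smooth i : smooth_on (cdom c) (fun p' => cmap c p' 0 i).
    by move=> d dA; exact: atlas_smooth.
  exists (cdom c) => //.
  apply: (@smooth_on_eq _ (fun p' => c0^-1 * flat 0 (r2 (cmap c p')))) => //.
    by move=> p' cp'; rewrite gE.
  apply: smooth_onM => //; first exact: smooth_on_cst.
  apply: smooth_on_flat => //; apply: smooth_onD => //.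
    exact: smooth_on_cst.
  apply: smooth_onM => //; first exact: smooth_on_cst.
  apply: smooth_on_sum => // i; apply: smooth_onM => //;
    by apply: smooth_onD => //; exact: smooth_on_cst.
exists (~` K); first by move=> /KW[].
by apply: smooth_on_eq (smooth_on_cst _ 0) => [|p' /gK->] //; exact: closed_openC.
Qed.

End ManifoldFunctions.

(** * Smooth sections and a global substitute for local frames *)

Section Sections.
Context {R : realType} {n : nat} {M : manifold R n} {A : vector_bundle M}.
Implicit Types (f g : M -> R) (X Y : vfield A) (alpha beta : cofield A).
Implicit Types (N : endofield A) (P : mfield A).

Lemma smooth_cst (a : R) : smooth (M := M) (fun=> a).
Proof. exact: smooth_on_cst. Qed.

Lemma smoothD f g : smooth f -> smooth g -> smooth (fun q => f q + g q).
Proof. exact/smooth_onD/openT. Qed.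

Lemma smoothM f g : smooth f -> smooth g -> smooth (fun q => f q * g q).
Proof. exact/smooth_onM/openT. Qed.

Lemma smoothN f : smooth f -> smooth (fun q => - f q).
Proof.
move=> fs; apply: smooth_on_eq openT _ (smoothM (smooth_cst (-1)) fs) => q _.
by rewrite mulN1r.
Qed.

Lemma smooth_in (W : set M) f : smooth f -> smooth_on W f.
Proof. exact: smooth_on_sub. Qed.
#[global] Arguments smooth_in {W f}.

Lemma smooth_triv f : (forall i : triv A, smooth_on (tdom i) f) -> smooth f.
Proof.
move=> fs; apply: smooth_on_local => q _.
by have [i iq] := tdom_cover A q; exists (tdom i).
Qed.

Lemma frame_expand (i : triv A) (p : M) (v : A p) : tdom i p ->
  v = \sum_j coord (frame i p) j v *: tnth (frame i p) j.
Proof.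
move=> /frame_basis B; rewrite {1}(coord_basis B (memvf v)).
by apply: eq_bigr => j _; rewrite (tnth_nth 0).
Qed.

Lemma coord_frame (i : triv A) (p : M) k j : tdom i p ->
  coord (frame i p) k (tnth (frame i p) j) = (j == k)%:R.
Proof. by move=> /frame_basis/basis_free B; rewrite (tnth_nth 0) coord_free. Qed.

Lemma coframeE (i : triv A) p j (v : A p) :
  coframe i p j v = coord (frame i p) j v.
Proof. by rewrite lfunE. Qed.

Lemma section_lin f X Y : smooth f -> smooth_section X -> smooth_section Y ->
  smooth_section (fun p => f p *: X p + Y p).
Proof.
move=> fs Xs Ys i j; have iop : open (tdom i) by exact: tdom_open.
apply: (smooth_on_eq iop _
  (smooth_onD iop (smooth_onM iop (smooth_in fs) (Xs i j)) (Ys i j))).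
by move=> p _; rewrite linearP.
Qed.

Lemma section0 : smooth_section (fun p => 0 : A p).
Proof.
move=> i j; apply: (smooth_on_eq (tdom_open i) _ (smooth_on_cst _ 0)) => p _.
by rewrite linear0.
Qed.

Lemma sectionZ f X : smooth f -> smooth_section X ->
  smooth_section (fun p => f p *: X p).
Proof.
move=> fs Xs; have := section_lin fs Xs section0.
by congr smooth_section; apply/functional_extensionality_dep => p; rewrite addr0.
Qed.

Lemma sectionD X Y : smooth_section X -> smooth_section Y ->
  smooth_section (fun p => X p + Y p).
Proof.
move=> Xs Ys; have := section_lin (smooth_cst 1) Xs Ys.
by congr smooth_section; apply/functional_extensionality_dep => p; rewrite scale1r.
Qed.

Lemma section_sum m (X : 'I_m -> vfield A) :
  (forall i, smooth_section (X i)) ->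
  smooth_section (fun p => \sum_i X i p).
Proof.
move=> Xs; elim: (index_enum _) => [|i r IH].
  have := section0; congr smooth_section.
  by apply/functional_extensionality_dep => p; rewrite big_nil.
have := sectionD (Xs i) IH; congr smooth_section.
by apply/functional_extensionality_dep => p; rewrite big_cons.
Qed.

Lemma cosection_lin f alpha beta :
  smooth f -> smooth_cosection alpha -> smooth_cosection beta ->
  smooth_cosection (fun p => f p *: alpha p + beta p).
Proof.
move=> fs als bs i j; have iop : open (tdom i) by exact: tdom_open.
apply: (smooth_on_eq iop _
  (smooth_onD iop (smooth_onM iop (smooth_in fs) (als i j)) (bs i j))).
by move=> p _; rewrite add_lfunE scale_lfunE.
Qed.

Lemma cosection_sum m (a : 'I_m -> R) (alpha : 'I_m -> cofield A) :
  (forall i, smooth_cosection (alpha i)) ->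
  smooth_cosection (fun p => \sum_i a i *: alpha i p).
Proof.
move=> als; elim: (index_enum _) => [|i r IH].
  move=> i j; apply: (smooth_on_eq (tdom_open i) _ (smooth_on_cst _ 0)) => p _.
  by rewrite big_nil zero_lfunE.
have := cosection_lin (smooth_cst (a i)) (als i) IH.
by congr smooth_cosection; apply/functional_extensionality_dep => p; rewrite big_cons.
Qed.

Lemma pairing_smooth alpha X : smooth_cosection alpha -> smooth_section X ->
  smooth (pairing alpha X).
Proof.
move=> als Xs; apply: smooth_triv => i; have iop : open (tdom i) by exact: tdom_open.
apply: (smooth_on_eq iop _ (smooth_on_sum iop (fun j =>
  smooth_onM iop (Xs i j) (als i j)))) => p ip.
rewrite /pairing [in RHS](frame_expand (X p) ip) linear_sum.
by apply: eq_bigr => j _; rewrite linearZ.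
Qed.

Lemma endo_app_smooth N X : bundle_endo N -> smooth_section X ->
  smooth_section (endo_app N X).
Proof.
move=> Ns Xs i k; have iop : open (tdom i) by exact: tdom_open.
apply: (smooth_on_eq iop _ (smooth_on_sum iop (fun j =>
  smooth_onM iop (Xs i j) (Ns i j k)))) => p ip.
rewrite /endo_app [in RHS](frame_expand (X p) ip) !linear_sum.
by apply: eq_bigr => j _; rewrite !linearZ.
Qed.

Lemma endo_dual_smooth N alpha : bundle_endo N -> smooth_cosection alpha ->
  smooth_cosection (endo_dual N alpha).
Proof.
move=> Ns als i j; have iop : open (tdom i) by exact: tdom_open.
apply: (smooth_on_eq iop _ (smooth_on_sum iop (fun k =>
  smooth_onM iop (Ns i j k) (als i k)))) => p ip.
rewrite /endo_dual comp_lfunE /= [in RHS](frame_expand (N p _) ip) linear_sum.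
by apply: eq_bigr => k _; rewrite linearZ.
Qed.

Lemma endo_pow_bundle N k : bundle_endo N -> bundle_endo (endo_pow N k).
Proof.
move=> Ns; elim: k => [|k IH] i j l; have iop : open (tdom i) by exact: tdom_open.
  apply: (smooth_on_eq iop _ (smooth_on_cst _ (j == l)%:R)) => p ip.
  by rewrite /= id_lfunE coord_frame.
apply: (smooth_on_eq iop _ (smooth_on_sum iop (fun m =>
  smooth_onM iop (IH i j m) (Ns i m l)))) => p ip.
rewrite /= comp_lfunE /= [in RHS](frame_expand (endo_pow N k p _) ip) !linear_sum.
by apply: eq_bigr => m _; rewrite !linearZ.
Qed.

(** The sections [X_j = h e_j] and [eps_j = h e^j], for a frame [e_j] near [q]
and a bump function [h], decompose everything as a frame does, up to the factor
[h ^ 2].  Choosing [h = g (2 - g)] makes [1 - h ^ 2] a product of two functions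
that vanish at [q]: every first-order operator then sees the factor [h ^ 2] as
the constant [1] at [q]. *)
Lemma local_frame (q : M) : exists (r : nat) (X : 'I_r -> vfield A)
    (eps : 'I_r -> cofield A) (f1 f2 : M -> R),
  [/\ forall j, smooth_section (X j), forall j, smooth_cosection (eps j),
      smooth f1 /\ smooth f2, f1 q = 0 /\ f2 q = 0 &
      forall p (v : A p),
        \sum_j eps j p v *: X j p = (1 - f1 p * f2 p) *: v].
Proof.
have [i iq] := tdom_cover A q.
have [g [K [gs g1 Kcl KW gK]]] := bump_function (tdom_open i) iq.
pose h p := g p * (2 + - g p).
have hs : smooth h.
  by apply: smoothM => //; apply: smoothD; [exact: smooth_cst|exact: smoothN].
have hK p : ~ K p -> h p = 0 by move=> /gK g0; rewrite /h g0 mul0r.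
exists (rank A), (fun j p => h p *: tnth (frame i p) j).
exists (fun j p => h p *: coframe i p j).
exists (fun p => 1 + - g p), (fun p => (1 + - g p) * (1 + h p)); split.
- move=> j i' k; apply: smooth_on_local => q' i'q'.
  have [/KW iq'|nKq'] := pselect (K q').
    exists (tdom i' `&` tdom i) => //.
    have iop : open (tdom i' `&` tdom i) by apply: openI; exact: tdom_open.
    apply: (smooth_on_eq iop _ (smooth_onM iop (smooth_in hs)
      (frame_smooth i' i k j))) => p _.
    by rewrite linearZ.
  exists (~` K) => //; apply: smooth_on_eq (smooth_on_cst _ 0).
    exact: closed_openC.
  by move=> p /hK h0; rewrite h0 scale0r linear0.
- move=> j i' k; apply: smooth_on_local => q' i'q'.
  have [/KW iq'|nKq'] := pselect (K q').
    exists (tdom i `&` tdom i') => //.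
    have iop : open (tdom i `&` tdom i') by apply: openI; exact: tdom_open.
    apply: (smooth_on_eq iop _ (smooth_onM iop (smooth_in hs)
      (frame_smooth i i' j k))) => p _.
    by rewrite scale_lfunE coframeE.
  exists (~` K) => //; apply: smooth_on_eq (smooth_on_cst _ 0).
    exact: closed_openC.
  by move=> p /hK h0; rewrite h0 scale0r zero_lfunE.
- have s1 : smooth (fun p => 1 + - g p).
    by apply: smoothD; [exact: smooth_cst|exact: smoothN].
  split=> //; apply: smoothM => //.
  by apply: smoothD => //; exact: smooth_cst.
- by rewrite g1 subrr mul0r.
(* [1 - h ^ 2 = (1 - g) ^ 2 (1 + h)] because [h = 1 - (1 - g) ^ 2]. *)
move=> p v; have -> : 1 - (1 + - g p) * ((1 + - g p) * (1 + h p)) = h p * h p.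
  by rewrite /h; ring.
have [/KW ip|/hK h0] := pselect (K p).
  rewrite -scalerA [in RHS](frame_expand v ip) !scaler_sumr.
  apply: eq_bigr => j _; rewrite scale_lfunE coframeE !scalerA /GRing.scale /=.
  by rewrite -mulrA [h p * coord _ _ _ * _]mulrC; congr (_ *: _); ring.
by rewrite h0 mul0r scale0r big1 // => j _; rewrite !scale0r scaler0.
Qed.

End Sections.

(** * Poisson-Nijenhuis calculus on a skew algebroid *)

Section Calculus.
Context {R : realType} {n : nat} {M : manifold R n} {A : vector_bundle M}.
Implicit Types (f g : M -> R) (X Y Z W : vfield A) (alpha beta gamma : cofield A).
Implicit Types (N Q : endofield A).

(** The type of the sharp maps of bivectors. *)
Definition comap := forall p : M, dual_fibre A p -> A p.
Implicit Types (P : comap).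

Definition comap_app P alpha : vfield A := fun p => P p (alpha p).

Record skew_comap P : Prop := {
  comap_app_smooth : forall alpha, smooth_cosection alpha ->
    smooth_section (comap_app P alpha);
  comap_skew : forall p (xi eta : dual_fibre A p),
    eta (P p xi) = - xi (P p eta) }.

Record skew_algebroid (br : vfield A -> vfield A -> vfield A)
    (rho : vfield A -> (M -> R) -> M -> R) : Prop := {
  br_section : forall X Y, smooth_section X -> smooth_section Y ->
    smooth_section (br X Y);
  br_skew : forall X Y q, smooth_section X -> smooth_section Y ->
    br X Y q = - br Y X q;
  br_add : forall X Y Z q,
    smooth_section X -> smooth_section Y -> smooth_section Z ->
    br X (fun p => Y p + Z p) q = br X Y q + br X Z q;
  br_leibniz : forall X f Y q,
    smooth_section X -> smooth f -> smooth_section Y ->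
    br X (fun p => f p *: Y p) q = f q *: br X Y q + rho X f q *: Y q;
  rho_linl : forall f X Y g q,
    smooth f -> smooth_section X -> smooth_section Y -> smooth g ->
    rho (fun p => f p *: X p + Y p) g q = f q * rho X g q + rho Y g q;
  rho_add : forall X f g q, smooth_section X -> smooth f -> smooth g ->
    rho X (fun p => f p + g p) q = rho X f q + rho X g q;
  rho_mul : forall X f g q, smooth_section X -> smooth f -> smooth g ->
    rho X (fun p => f p * g p) q = rho X f q * g q + f q * rho X g q }.

Context {br : vfield A -> vfield A -> vfield A}.
Context {rho : vfield A -> (M -> R) -> M -> R}.
Context (alg : skew_algebroid br rho).

Let br_smooth := br_section alg.

Local Hint Resolve smooth_cst smoothD smoothM smoothN sectionZ sectionD section0
  pairing_smooth endo_app_smooth endo_dual_smooth endo_pow_bundle comap_app_smooth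
  br_smooth : smooth.
Local Ltac sm := solve [auto 8 with smooth].

(** ** First-order operators *)

Lemma rho_opp X f q : smooth_section X -> smooth f ->
  rho X (fun p => - f p) q = - rho X f q.
Proof.
move=> Xs fs; have rho0 : rho X (fun=> 0) q = 0.
  have := rho_add alg q Xs (smooth_cst 0) (smooth_cst 0).
  have -> : (fun=> 0 + 0) = (fun=> 0) :> (M -> R) by rewrite addr0.
  by move=> h; lra.
have := rho_add alg q Xs fs (smoothN fs).
have -> : (fun p => f p - f p) = (fun=> 0) by apply/funext => p; rewrite subrr.
by rewrite rho0 => h; lra.
Qed.

(** The second condition says that [t X] depends on the first-order jet of [X]
at [q] only. *)
Definition first_order q (t : vfield A -> R) : Prop :=
  (forall X Y, smooth_section X -> smooth_section Y ->
     t (fun p => X p + Y p) = t X + t Y) /\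
  (forall f g X, smooth f -> smooth g -> smooth_section X ->
     f q = 0 -> g q = 0 -> t (fun p => (f p * g p) *: X p) = 0).

Lemma first_orderD q t1 t2 : first_order q t1 -> first_order q t2 ->
  first_order q (fun X => t1 X + t2 X).
Proof.
move=> [a1 z1] [a2 z2]; split=> [X Y Xs Ys|f g X *].
  by rewrite a1 // a2 // addrACA.
by rewrite z1 // z2 // addr0.
Qed.

Lemma first_orderN q t : first_order q t -> first_order q (fun X => - t X).
Proof.
move=> [a z]; split=> [X Y Xs Ys|f g X *].
  by rewrite a // opprD.
by rewrite z // oppr0.
Qed.

Lemma first_order_br q (xi : dual_fibre A q) X : smooth_section X ->
  first_order q (fun Y => xi (br X Y q)).
Proof.
move=> Xs; split=> [Y Z Ys Zs|f g Y fs gs Ys f0 g0].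
  by rewrite (br_add alg) // linearD.
rewrite (br_leibniz alg) //; last sm.
by rewrite (rho_mul alg) // f0 g0 !(mul0r, mulr0) addr0 !scale0r addr0 linear0.
Qed.

Lemma first_order_brl q (xi : dual_fibre A q) Y : smooth_section Y ->
  first_order q (fun X => xi (br X Y q)).
Proof.
move=> Ys; have [a z] := first_orderN (first_order_br xi Ys).
have sw X : smooth_section X -> xi (br X Y q) = - xi (br Y X q).
  by move=> Xs; rewrite (br_skew alg) // linearN.
split=> [X X' Xs Xs'|f g X fs gs Xs f0 g0]; rewrite !sw; try sm.
Qed.

Lemma rho_section0 f q : smooth f -> rho (fun p => 0 : A p) f q = 0.
Proof.
move=> fs; have := rho_linl alg q (smooth_cst 1) section0 section0 fs.
have -> : (fun p => 1 *: 0 + 0) = (fun p => 0 : A p).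
  by apply/functional_extensionality_dep => p; rewrite scale1r addr0.
by move=> h; lra.
Qed.

Lemma first_order_rho q f : smooth f -> first_order q (fun X => rho X f q).
Proof.
move=> fs; split=> [X Y Xs Ys|g1 g2 X g1s g2s Xs g10 g20].
  have := rho_linl alg q (smooth_cst 1) Xs Ys fs; rewrite mul1r => <-.
  by congr rho; apply/functional_extensionality_dep => p; rewrite scale1r.
have := rho_linl alg q (smoothM g1s g2s) Xs section0 fs.
rewrite g10 mul0r mul0r rho_section0 // addr0 => <-.
by congr rho; apply/functional_extensionality_dep => p; rewrite addr0.
Qed.

Lemma first_order_rho_pairing q X beta :
  smooth_section X -> smooth_cosection beta ->
  first_order q (fun Y => rho X (pairing beta Y) q).
Proof.
move=> Xs bs; split=> [Y Z Ys Zs|f g Y fs gs Ys f0 g0].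
  rewrite -(rho_add alg) //; try sm; congr rho.
  by apply/funext => p; rewrite /pairing linearD.
rewrite [X in rho _ X](_ : _ = fun p => (f p * g p) * pairing beta Y p).
  by rewrite !(rho_mul alg) //; try sm; rewrite f0 g0 !(mul0r, mulr0) !addr0 mul0r.
by apply/funext => p; rewrite /pairing linearZ.
Qed.

(** A first-order operator at [q] does not distinguish [W] from
[(1 - f1 f2) W] when [f1] and [f2] vanish at [q]. *)
Lemma first_order_local q t m (X : 'I_m -> vfield A) W f1 f2 :
  first_order q t -> (forall j, smooth_section (X j)) -> smooth_section W ->
  smooth f1 -> smooth f2 -> f1 q = 0 -> f2 q = 0 ->
  (forall p, \sum_j X j p = (1 - f1 p * f2 p) *: W p) ->
  t W = \sum_j t (X j).
Proof.
move=> [ta tz] Xs Ws f1s f2s f10 f20 XW.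
have t0 : t (fun p => 0) = 0.
  have := tz _ _ _ f1s f1s section0 f10 f10.
  by congr (t _ = _); apply/functional_extensionality_dep => p; rewrite scaler0.
have t_sum : t (fun p => \sum_j X j p) = \sum_j t (X j) /\
    smooth_section (fun p => \sum_j X j p).
  elim: (index_enum _) => [|j s [IH sIH]].
    rewrite big_nil -[X in _ = X]t0.
    have E : (fun p => \sum_(j <- [::]) X j p) = (fun p => 0).
      by apply/functional_extensionality_dep => p; rewrite big_nil.
    by rewrite E; split=> //; exact: section0.
  have E : (fun p => \sum_(i <- j :: s) X i p) =
           (fun p => X j p + \sum_(i <- s) X i p).
    by apply/functional_extensionality_dep => p; rewrite big_cons.
  by rewrite E big_cons ta // IH; split=> //; sm.
case: t_sum => <- sXs.
rewrite -[RHS]addr0 -(tz _ _ _ f1s f2s Ws f10 f20) -ta //; last sm.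
congr t; apply/functional_extensionality_dep => p.
by rewrite XW -scalerDl subrK scale1r.
Qed.

(** ** Powers of a Nijenhuis operator *)

Lemma covector_separated p (u v : A p) :
  (forall xi : dual_fibre A p, xi u = xi v) -> u = v.
Proof.
move=> uv; have [i ip] := tdom_cover A p.
rewrite (frame_expand u ip) (frame_expand v ip).
by apply: eq_bigr => j _; rewrite -!coframeE uv.
Qed.

(** The polarised form of the Nijenhuis torsion for commuting [Q] and [N]; it makes
an induction on the powers possible. *)
Definition mixed_torsion Q N X Y : vfield A := fun q =>
  br (endo_app Q X) (endo_app N Y) q - N q (br (endo_app Q X) Y q)
  - Q q (br X (endo_app N Y) q) + Q q (N q (br X Y q)).

Definition torsion_free Q N : Prop := forall X Y q,
  smooth_section X -> smooth_section Y -> mixed_torsion Q N X Y q = 0.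

Lemma endo_powS N k p v : endo_pow N k.+1 p v = N p (endo_pow N k p v).
Proof. by rewrite comp_lfunE. Qed.

Lemma endo_powSr N k p v : endo_pow N k.+1 p v = endo_pow N k p (N p v).
Proof.
elim: k v => [|k IH] v; first by rewrite endo_powS !id_lfunE.
by rewrite !endo_powS -IH endo_powS.
Qed.

Lemma endo_powD N k l p v :
  endo_pow N (k + l) p v = endo_pow N k p (endo_pow N l p v).
Proof.
elim: k => [|k IH]; first by rewrite id_lfunE.
by rewrite addSn !endo_powS IH.
Qed.

Lemma endo_app_powS N k X : endo_app (endo_pow N k.+1) X =
  endo_app N (endo_app (endo_pow N k) X).
Proof. by apply/functional_extensionality_dep => p; rewrite /endo_app comp_lfunE. Qed.

Lemma endo_app_pow0 N X : endo_app (endo_pow N 0) X = X.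
Proof. by apply/functional_extensionality_dep => p; rewrite /endo_app id_lfunE. Qed.

Lemma torsion_free_id N : torsion_free (endo_pow N 0) N.
Proof.
move=> X Y q _ _; apply: covector_separated => xi.
by rewrite /mixed_torsion endo_app_pow0 !id_lfunE !(linearB, linearD) linear0 /=; ring.
Qed.

(** [T(N Q, N)(X, Y) = T(N, N)(Q X, Y) + N T(Q, N)(X, Y)]. *)
Lemma torsion_free_powl N k : bundle_endo N -> torsion_free N N ->
  torsion_free (endo_pow N k) N.
Proof.
move=> Ns TN; elim: k => [|k IH]; first exact: torsion_free_id.
move=> X Y q Xs Ys; apply: covector_separated => xi.
have Xs' : smooth_section (endo_app (endo_pow N k) X) by sm.
have /(congr1 xi) := TN _ _ q Xs' Ys.
have /(congr1 (fun v => xi (N q v))) := IH _ _ q Xs Ys.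
rewrite /mixed_torsion endo_app_powS !endo_powS.
rewrite !(linearB, linearD, linear0) /= => h1 h2.
lra.
Qed.

(** [T(Q, N Q')(X, Y) = T(Q, N)(X, Q' Y) + N T(Q, Q')(X, Y)] when [Q] and [N]
commute. *)
Lemma torsion_free_pow N k l : bundle_endo N -> torsion_free N N ->
  torsion_free (endo_pow N k) (endo_pow N l).
Proof.
move=> Ns TN; have TkN := torsion_free_powl k Ns TN.
elim: l => [|l IH] X Y q Xs Ys; apply: covector_separated => xi.
  by rewrite /mixed_torsion endo_app_pow0 !id_lfunE !(linearB, linearD) linear0 /=; ring.
have Ys' : smooth_section (endo_app (endo_pow N l) Y) by sm.
have /(congr1 xi) := TkN _ _ q Xs Ys'.
have /(congr1 (fun v => xi (N q v))) := IH _ _ q Xs Ys.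
rewrite /mixed_torsion endo_app_powS !endo_powS -!endo_powSr !endo_powS.
rewrite !(linearB, linearD, linear0) /= => h1 h2.
lra.
Qed.

Definition commuting P N : Prop :=
  forall p (xi : dual_fibre A p), N p (P p xi) = P p (xi \o N p)%VF.

Definition post N P : comap := fun p xi => N p (P p xi).

Lemma comap_app_post N P alpha :
  comap_app (post N P) alpha = endo_app N (comap_app P alpha).
Proof. by []. Qed.

Lemma comap_app_dual N P alpha : commuting P N ->
  comap_app P (endo_dual N alpha) = endo_app N (comap_app P alpha).
Proof.
by move=> c; apply/functional_extensionality_dep => p; rewrite /endo_app /comap_app c.
Qed.

Lemma endo_dualE N alpha p v : endo_dual N alpha p v = alpha p (N p v).
Proof. by rewrite comp_lfunE. Qed.

Lemma pairing_dual N alpha X :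
  pairing (endo_dual N alpha) X = pairing alpha (endo_app N X).
Proof. by apply/funext => p; rewrite /pairing /endo_dual comp_lfunE. Qed.

Lemma commuting_pow P N k : commuting P N -> commuting P (endo_pow N k).
Proof.
move=> c; elim: k => [|k IH] p xi; first by rewrite id_lfunE comp_lfun1r.
rewrite endo_powSr c IH; congr (P p _).
by apply/lfunP => v; rewrite [LHS]comp_lfunE [LHS]comp_lfunE [RHS]comp_lfunE endo_powS.
Qed.

Lemma post_skew N P : bundle_endo N -> commuting P N -> skew_comap P ->
  skew_comap (post N P).
Proof.
move=> Ns c [Ps Pa]; split=> [alpha als|p xi eta].
  exact: endo_app_smooth Ns (Ps _ als).
by rewrite /post c -[eta _]/(eta _) Pa comp_lfunE.
Qed.

(** ** The concomitant of a bivector and an operator *)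

(** The pairing with [Y] of the bracket
[[alpha, beta]_P = L_{P alpha} beta - L_{P beta} alpha - d <beta, P alpha>]. *)
Definition cobr P alpha beta Y q : R :=
  rho (comap_app P alpha) (pairing beta Y) q - beta q (br (comap_app P alpha) Y q)
  - (rho (comap_app P beta) (pairing alpha Y) q - alpha q (br (comap_app P beta) Y q))
  - rho Y (pairing beta (comap_app P alpha)) q.

(** The Magri-Morosi concomitant
[<beta, (L_{P alpha} N) Y> - <alpha, (L_{P beta} N) Y>
 + rho (N Y) <beta, P alpha> - rho Y <beta, N P alpha>]. *)
Definition concomitant P N alpha beta Y q : R :=
  beta q (br (comap_app P alpha) (endo_app N Y) q - N q (br (comap_app P alpha) Y q))
  - alpha q (br (comap_app P beta) (endo_app N Y) q - N q (br (comap_app P beta) Y q))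
  + rho (endo_app N Y) (pairing beta (comap_app P alpha)) q
  - rho Y (pairing beta (endo_app N (comap_app P alpha))) q.

Definition concomitant_free P N : Prop := forall alpha beta Y q,
  smooth_cosection alpha -> smooth_cosection beta -> smooth_section Y ->
  concomitant P N alpha beta Y q = 0.

Lemma concomitantE P N alpha beta Y q : commuting P N ->
  concomitant P N alpha beta Y q =
    cobr P (endo_dual N alpha) beta Y q + cobr P alpha (endo_dual N beta) Y q
    - cobr P alpha beta (endo_app N Y) q - cobr (post N P) alpha beta Y q.
Proof.
move=> c; rewrite /concomitant /cobr !comap_app_dual // !pairing_dual !comap_app_post.
rewrite /endo_dual !comp_lfunE !linearB /=.
ring.
Qed.

(** [concomitant (N P) N alpha beta Y = concomitant P N (endo_dual N alpha) beta Y
 - <alpha, T(N, N)(P beta, Y)>]. *)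
Lemma concomitant_free_post P N : bundle_endo N -> skew_comap P ->
  commuting P N -> torsion_free N N -> concomitant_free P N ->
  concomitant_free (post N P) N.
Proof.
move=> Ns Ps c TN D alpha beta Y q als bs Ys.
have Pb : smooth_section (comap_app P beta) by exact: comap_app_smooth.
have := D _ _ _ q (endo_dual_smooth Ns als) bs Ys.
have /(congr1 (alpha q)) := TN _ _ q Pb Ys.
rewrite /concomitant /mixed_torsion !comap_app_dual // !comap_app_post /endo_dual.
rewrite !comp_lfunE !(linearB, linearD, linear0) /=.
move=> T0 D0; rewrite -[RHS]D0; lra.
Qed.

(** For [Q] commuting with [N],
[concomitant P (Q N) alpha beta Y = concomitant P Q alpha beta (N Y)
 + concomitant P N alpha (endo_dual Q beta) Y + <alpha, T(Q, N)(P beta, Y)>]. *)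
Lemma concomitant_free_pow P N k : bundle_endo N -> skew_comap P ->
  commuting P N -> torsion_free N N -> concomitant_free P N ->
  concomitant_free P (endo_pow N k).
Proof.
move=> Ns Ps c TN D; elim: k => [|k IH] alpha beta Y q als bs Ys.
  by rewrite /concomitant !endo_app_pow0 !id_lfunE !subrr !linear0; ring.
have Pb : smooth_section (comap_app P beta) by exact: comap_app_smooth.
have Qs := endo_pow_bundle k Ns.
have D1 := IH _ _ _ q als bs (endo_app_smooth Ns Ys).
have D2 := D _ _ _ q als (endo_dual_smooth Qs bs) Ys.
have /(congr1 (alpha q)) T0 := torsion_free_powl k Ns TN q Pb Ys.
have E Z : endo_app (endo_pow N k.+1) Z = endo_app (endo_pow N k) (endo_app N Z).
  by apply/functional_extensionality_dep => p; rewrite /endo_app endo_powSr.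
have E' Z : endo_app N (endo_app (endo_pow N k) Z) =
            endo_app (endo_pow N k) (endo_app N Z) by rewrite -E endo_app_powS.
move: D1 D2 T0.
rewrite /concomitant /mixed_torsion comap_app_dual; last exact: commuting_pow.
rewrite !pairing_dual !E ?E' !endo_dualE !endo_powSr.
rewrite !(linearB, linearD, linear0) /=.
lra.
Qed.

(** ** The polarised Schouten bracket of two bivectors *)

(** The terms of the Schouten bracket of [P] with a second bivector, evaluated on
three one-forms, that contain the contraction [W] of the second bivector with
the first form. *)
Definition schouten_arg P beta gamma W q : R :=
  rho W (pairing beta (comap_app P gamma)) q + rho (comap_app P beta) (pairing gamma W) q
  + gamma q (br W (comap_app P beta) q) + beta q (br (comap_app P gamma) W q).

Definition schouten3 P1 P2 alpha beta gamma q : R :=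
  schouten_arg P1 beta gamma (comap_app P2 alpha) q
  + schouten_arg P1 gamma alpha (comap_app P2 beta) q
  + schouten_arg P1 alpha beta (comap_app P2 gamma) q.

Definition schouten3_free P1 P2 : Prop := forall alpha beta gamma q,
  smooth_cosection alpha -> smooth_cosection beta -> smooth_cosection gamma ->
  schouten3 P1 P2 alpha beta gamma q = 0.

Lemma pairing_skew P alpha beta : skew_comap P ->
  pairing alpha (comap_app P beta) = fun p => - pairing beta (comap_app P alpha) p.
Proof. by move=> Ps; apply/funext => p; rewrite /pairing /comap_app comap_skew. Qed.

(** For [P1 = P2 = P] the right-hand side is, up to the factor [2], the defect
[<gamma, [P alpha, P beta]> - <gamma, P [alpha, beta]_P>]: so the Poisson
condition says that [P] is a morphism of brackets. *)
Lemma schouten3E P1 P2 alpha beta gamma q : skew_comap P1 -> skew_comap P2 ->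
  smooth_cosection alpha -> smooth_cosection beta -> smooth_cosection gamma ->
  schouten3 P1 P2 alpha beta gamma q =
    cobr P2 alpha beta (comap_app P1 gamma) q + cobr P1 alpha beta (comap_app P2 gamma) q
    + gamma q (br (comap_app P1 alpha) (comap_app P2 beta) q)
    + gamma q (br (comap_app P2 alpha) (comap_app P1 beta) q).
Proof.
move=> s1 s2 als bs gs; rewrite /schouten3 /schouten_arg /cobr.
rewrite (pairing_skew gamma alpha s1) (pairing_skew alpha beta s2) .
rewrite (pairing_skew gamma alpha s2) (pairing_skew alpha beta s1) .
rewrite !rho_opp; try sm.
rewrite (br_skew alg (X := comap_app P1 gamma) (Y := comap_app P2 alpha)); try sm.
rewrite (br_skew alg (X := comap_app P2 gamma) (Y := comap_app P1 alpha)); try sm.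
rewrite !linearN /=; ring.
Qed.

Lemma schouten3_free_br P alpha beta gamma q : skew_comap P ->
  schouten3_free P P ->
  smooth_cosection alpha -> smooth_cosection beta -> smooth_cosection gamma ->
  cobr P alpha beta (comap_app P gamma) q =
    - gamma q (br (comap_app P alpha) (comap_app P beta) q).
Proof.
move=> Ps PP als bs gs; have := PP _ _ _ q als bs gs.
rewrite schouten3E //; lra.
Qed.

Lemma cobr_post P N alpha beta Y q : commuting P N -> concomitant_free P N ->
  smooth_cosection alpha -> smooth_cosection beta -> smooth_section Y ->
  cobr (post N P) alpha beta Y q =
    cobr P (endo_dual N alpha) beta Y q + cobr P alpha (endo_dual N beta) Y q
    - cobr P alpha beta (endo_app N Y) q.
Proof.
move=> c D als bs Ys; have := D _ _ _ q als bs Ys.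
by rewrite concomitantE // => h; lra.
Qed.

Lemma schouten3_free_post P N : bundle_endo N -> skew_comap P ->
  commuting P N -> concomitant_free P N -> schouten3_free P P ->
  schouten3_free P (post N P).
Proof.
move=> Ns Ps c D PP alpha beta gamma q als bs gs.
have Ps' := post_skew Ns c Ps.
rewrite schouten3E // cobr_post //; try sm.
rewrite !schouten3_free_br //; try sm.
rewrite !comap_app_post -(comap_app_dual gamma c) schouten3_free_br //; try sm.
rewrite !comap_app_dual // endo_dualE; ring.
Qed.

Lemma schouten3_free_post2 P N : bundle_endo N -> skew_comap P ->
  commuting P N -> torsion_free N N -> concomitant_free P N ->
  schouten3_free P P -> schouten3_free (post N P) (post N P).
Proof.
move=> Ns Ps c TN D PP alpha beta gamma q als bs gs.
have Ps' := post_skew Ns c Ps.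
have Pa : smooth_section (comap_app P alpha) by sm.
have Pb : smooth_section (comap_app P beta) by sm.
have /(congr1 (gamma q)) := TN _ _ q Pa Pb.
rewrite schouten3E // cobr_post //; try sm.
rewrite !comap_app_post -!(comap_app_dual gamma c).
rewrite -(comap_app_dual (endo_dual N gamma) c) !schouten3_free_br //; try sm.
rewrite !comap_app_dual // !endo_dualE /mixed_torsion.
rewrite !(linearB, linearD, linear0) /=; lra.
Qed.

(** ** Evaluation on decomposable bivectors *)

(** [(L_Y P)(alpha, beta)], written with the skew-symmetry of [P] so that no Lie
derivative of a one-form is needed. *)
Definition lie_bivector P Y alpha beta q : R :=
  (- rho Y (pairing beta (comap_app P alpha)) q + beta q (br Y (comap_app P alpha) q))
  - alpha q (br Y (comap_app P beta) q).

Definition wedge_comap Y Z : comap :=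
  fun p xi => xi (Y p) *: Z p - xi (Z p) *: Y p.

Lemma comap_app_wedge Y Z alpha : comap_app (wedge_comap Y Z) alpha =
  fun p => pairing alpha Y p *: Z p - pairing alpha Z p *: Y p.
Proof. by []. Qed.

Lemma wedge_comap_smooth Y Z alpha :
  smooth_section Y -> smooth_section Z -> smooth_cosection alpha ->
  smooth_section (comap_app (wedge_comap Y Z) alpha).
Proof.
move=> Ys Zs als; have : smooth_section (fun p => pairing alpha Y p *: Z p +
    (- pairing alpha Z p) *: Y p) by sm.
congr smooth_section; apply/functional_extensionality_dep => p.
by rewrite scaleNr.
Qed.

Local Hint Resolve wedge_comap_smooth : smooth.

(** A first-order operator at [q] cannot tell the sum of the [Q j] from [P]. *)
Definition comap_decomposes q P m (Q : 'I_m -> comap) : Prop :=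
  exists f1 f2, [/\ smooth f1, smooth f2, f1 q = 0, f2 q = 0 &
    forall p (xi : dual_fibre A p),
      \sum_j Q j p xi = (1 - f1 p * f2 p) *: P p xi].

Lemma decomposes_local q t P m (Q : 'I_m -> comap) alpha : first_order q t ->
  smooth_section (comap_app P alpha) ->
  (forall j, smooth_section (comap_app (Q j) alpha)) ->
  comap_decomposes q P Q ->
  t (comap_app P alpha) = \sum_j t (comap_app (Q j) alpha).
Proof.
move=> ft Ps Qs [f1 [f2 [f1s f2s f10 f20 QP]]].
by apply: first_order_local ft Qs Ps f1s f2s f10 f20 _ => p; exact: QP.
Qed.

Lemma lie_bivector_local q P m (Q : 'I_m -> comap) Y alpha beta :
  smooth_section Y -> smooth_cosection alpha -> smooth_cosection beta ->
  (forall gamma, smooth_cosection gamma -> smooth_section (comap_app P gamma)) ->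
  (forall j gamma, smooth_cosection gamma -> smooth_section (comap_app (Q j) gamma)) ->
  comap_decomposes q P Q ->
  lie_bivector P Y alpha beta q = \sum_j lie_bivector (Q j) Y alpha beta q.
Proof.
move=> Ys als bs Ps Qs QP; rewrite /lie_bivector.
have t1 := first_orderD (first_orderN (first_order_rho_pairing q Ys bs))
  (first_order_br (beta q) Ys).
have t2 := first_order_br (alpha q) Ys.
rewrite (decomposes_local t1 (Ps _ als) (fun j => Qs j _ als) QP) /=.
rewrite (decomposes_local t2 (Ps _ bs) (fun j => Qs j _ bs) QP) /=.
by rewrite -sumrB.
Qed.

Lemma first_order_schouten_arg q P beta gamma : skew_comap P ->
  smooth_cosection beta -> smooth_cosection gamma ->
  first_order q (fun W => schouten_arg P beta gamma W q).
Proof.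
move=> Ps bs gs; rewrite /schouten_arg.
apply: first_orderD (first_order_br _ _); last sm.
apply: first_orderD (first_order_brl _ _); last sm.
apply: first_orderD (first_order_rho_pairing _ _ _); try sm.
apply: first_order_rho; sm.
Qed.

Lemma schouten3_local q P1 P2 m (Q : 'I_m -> comap) alpha beta gamma :
  skew_comap P1 ->
  smooth_cosection alpha -> smooth_cosection beta -> smooth_cosection gamma ->
  (forall gamma, smooth_cosection gamma -> smooth_section (comap_app P2 gamma)) ->
  (forall j gamma, smooth_cosection gamma -> smooth_section (comap_app (Q j) gamma)) ->
  comap_decomposes q P2 Q ->
  schouten3 P1 P2 alpha beta gamma q =
    \sum_j schouten3 P1 (Q j) alpha beta gamma q.
Proof.
move=> Ps als bs gs P2s Qs QP; rewrite /schouten3 big_split [X in _ = X + _]big_split /=.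
have dec t a (ft : first_order q t) (a_s : smooth_cosection a) :=
  decomposes_local ft (P2s _ a_s) (fun j => Qs j _ a_s) QP.
rewrite (dec _ _ (first_order_schouten_arg q Ps bs gs) als).
rewrite (dec _ _ (first_order_schouten_arg q Ps gs als) bs).
by rewrite (dec _ _ (first_order_schouten_arg q Ps als bs) gs).
Qed.

Lemma br_comb X alpha beta Y Z q (xi : dual_fibre A q) :
  smooth_section X -> smooth_section Y -> smooth_section Z ->
  smooth_cosection alpha -> smooth_cosection beta ->
  xi (br X (fun p => pairing alpha Y p *: Z p - pairing beta Z p *: Y p) q) =
  alpha q (Y q) * xi (br X Z q) + rho X (pairing alpha Y) q * xi (Z q)
  - (beta q (Z q) * xi (br X Y q) + rho X (pairing beta Z) q * xi (Y q)).
Proof.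
move=> Xs Ys Zs als bs.
have -> : (fun p => pairing alpha Y p *: Z p - pairing beta Z p *: Y p) =
          (fun p => pairing alpha Y p *: Z p + (- pairing beta Z p) *: Y p).
  by apply/functional_extensionality_dep => p; rewrite scaleNr.
rewrite (br_add alg) //; try sm.
rewrite !(br_leibniz alg) //; try sm.
rewrite rho_opp //; try sm.
rewrite !linearD !linearZ /= /GRing.scale /=; ring.
Qed.

Lemma rho_wedge X alpha beta Y Z q :
  smooth_section X -> smooth_section Y -> smooth_section Z ->
  smooth_cosection alpha -> smooth_cosection beta ->
  rho X (pairing beta (comap_app (wedge_comap Y Z) alpha)) q =
  rho X (pairing alpha Y) q * beta q (Z q) + alpha q (Y q) * rho X (pairing beta Z) q
  - (rho X (pairing alpha Z) q * beta q (Y q) + alpha q (Z q) * rho X (pairing beta Y) q).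
Proof.
move=> Xs Ys Zs als bs.
have -> : pairing beta (comap_app (wedge_comap Y Z) alpha) =
  (fun p => pairing alpha Y p * pairing beta Z p +
          - (pairing alpha Z p * pairing beta Y p)).
  by apply/funext => p; rewrite /pairing comap_app_wedge linearB !linearZ.
rewrite (rho_add alg) ?rho_opp //; try sm.
by rewrite !(rho_mul alg) //; sm.
Qed.

Lemma rho_comb alpha beta Y Z g q : smooth g ->
  smooth_section Y -> smooth_section Z ->
  smooth_cosection alpha -> smooth_cosection beta ->
  rho (fun p => pairing alpha Y p *: Z p - pairing beta Z p *: Y p) g q =
  alpha q (Y q) * rho Z g q - beta q (Z q) * rho Y g q.
Proof.
move=> gs Ys Zs als bs.
have -> : (fun p => pairing alpha Y p *: Z p - pairing beta Z p *: Y p) =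
   (fun p => pairing alpha Y p *: Z p +
      ((- pairing beta Z p) *: Y p + (fun p => 0 : A p) p)).
  by apply/functional_extensionality_dep => p; rewrite addr0 scaleNr.
rewrite (rho_linl alg) //; try sm.
rewrite (rho_linl alg) //; try sm.
by rewrite rho_section0 // addr0 mulNr.
Qed.

Lemma br_combl X alpha beta Y Z q (xi : dual_fibre A q) :
  smooth_section X -> smooth_section Y -> smooth_section Z ->
  smooth_cosection alpha -> smooth_cosection beta ->
  xi (br (fun p => pairing alpha Y p *: Z p - pairing beta Z p *: Y p) X q) =
  - (alpha q (Y q) * xi (br X Z q) + rho X (pairing alpha Y) q * xi (Z q)
  - (beta q (Z q) * xi (br X Y q) + rho X (pairing beta Z) q * xi (Y q))).
Proof.
move=> Xs Ys Zs als bs.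
have comb_smooth :
    smooth_section (fun p => pairing alpha Y p *: Z p - pairing beta Z p *: Y p).
  have -> : (fun p => pairing alpha Y p *: Z p - pairing beta Z p *: Y p) =
            (fun p => pairing alpha Y p *: Z p + (- pairing beta Z p) *: Y p).
    by apply/functional_extensionality_dep => p; rewrite scaleNr.
  sm.
by rewrite (br_skew alg q comb_smooth Xs) linearN /= br_comb.
Qed.

Lemma lie_bivector_wedge Y Z W alpha beta q :
  smooth_section Y -> smooth_section Z -> smooth_section W ->
  smooth_cosection alpha -> smooth_cosection beta ->
  lie_bivector (wedge_comap Z W) Y alpha beta q =
    alpha q (br Y Z q) * beta q (W q) - beta q (br Y Z q) * alpha q (W q)
    + (alpha q (Z q) * beta q (br Y W q) - beta q (Z q) * alpha q (br Y W q)).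
Proof.
move=> Ys Zs Ws als bs; rewrite /lie_bivector rho_wedge // !comap_app_wedge.
rewrite !br_comb //; ring.
Qed.

(** The classical rule [[P, Y /\ Z] = Y /\ L_Z P - Z /\ L_Y P]; the terms in which
[P beta] differentiates the pairings of [Y] and [Z] with forms cancel in the
cyclic sum. *)
Lemma schouten3_wedge P Y Z alpha beta gamma q : skew_comap P ->
  smooth_section Y -> smooth_section Z ->
  smooth_cosection alpha -> smooth_cosection beta -> smooth_cosection gamma ->
  schouten3 P (wedge_comap Y Z) alpha beta gamma q =
    alpha q (Y q) * lie_bivector P Z beta gamma q
    - beta q (Y q) * lie_bivector P Z alpha gamma q
    + gamma q (Y q) * lie_bivector P Z alpha beta q
    - (alpha q (Z q) * lie_bivector P Y beta gamma q
    - beta q (Z q) * lie_bivector P Y alpha gamma q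
    + gamma q (Z q) * lie_bivector P Y alpha beta q).
Proof.
move=> Ps Ys Zs als bs gs.
rewrite /schouten3 /schouten_arg /lie_bivector !rho_wedge //; try sm.
rewrite !comap_app_wedge !rho_comb //; try sm.
rewrite !br_combl //; try sm.
rewrite !br_comb //; try sm.
rewrite (pairing_skew gamma alpha Ps) (pairing_skew beta alpha Ps)
  (pairing_skew gamma beta Ps).
rewrite !rho_opp //; try sm.
have sw W a : smooth_section W -> smooth_cosection a ->
    br W (comap_app P a) q = - br (comap_app P a) W q.
  by move=> Ws a_s; apply: (br_skew alg); sm.
rewrite !(sw Y) // !(sw Z) // !linearN /=; ring.
Qed.

End Calculus.

(** * Wedge products of multisections of low degree *)

Lemma sum_tuple0 (V : nmodType) (F : 0.-tuple bool -> V) :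
  \sum_(m : 0.-tuple bool) F m = F [tuple].
Proof.
rewrite (eq_bigl (pred1 [tuple])) ?big_pred1_eq // => m.
by rewrite [m]tuple0 /= eqxx.
Qed.

Lemma sum_tupleS (V : nmodType) k (F : k.+1.-tuple bool -> V) :
  \sum_(m : k.+1.-tuple bool) F m =
  \sum_(m : k.-tuple bool) F [tuple of true :: m] +
  \sum_(m : k.-tuple bool) F [tuple of false :: m].
Proof.
pose tcons (bm : bool * k.-tuple bool) := [tuple of bm.1 :: bm.2].
rewrite (reindex tcons) /=; last first.
  exists (fun m => (thead m, [tuple of behead m])) => [[b m]|m] _ //=.
    by congr pair; apply: val_inj.
  by rewrite /tcons -tuple_eta.
by rewrite -(pair_bigA _ (fun b m => F (tcons (b, m)))) /= big_bool.
Qed.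

Lemma shuffle_inv0 : shuffle_inv [tuple] = 0%N.
Proof. by rewrite /shuffle_inv big_ord0. Qed.

(** A leading [false] is passed by every later [true]. *)
Lemma shuffle_invS k b (m : k.-tuple bool) :
  shuffle_inv [tuple of b :: m] = (~~ b * count id m + shuffle_inv m)%N.
Proof.
rewrite /shuffle_inv big_ord_recl; congr (_ + _)%N.
  rewrite big_ord_recl /= add0n.
  transitivity (\sum_(j < k) (~~ b * tnth m j))%N.
    by apply: eq_bigr => j _; rewrite tnth0 tnthS mulnb.
  rewrite -big_distrr /=; congr (_ * _)%N.
  rewrite -[in RHS](map_tnth_enum m) count_map -sum1_count.
  rewrite big_enum_cond [in RHS]big_mkcond.
  by apply: eq_bigr => j _ /=; case: (tnth m j).
apply: eq_bigr => i _; rewrite big_ord_recl /= add0n.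
by apply: eq_bigr => j _; rewrite !tnthS.
Qed.

Section LowDegreeWedges.
Context {R : realType} {n : nat} {M : manifold R n} {A : vector_bundle M}.
Implicit Types (f g : M -> R) (X Y Z : vfield A) (D : mfield A).

Definition has_degree k D : Prop := forall p s, size s != k -> D p s = 0.

Lemma multisection_degree k D : multisection k D -> has_degree k D.
Proof. by case. Qed.

Lemma mwedge_degree k l D1 D2 : has_degree k D1 -> has_degree l D2 ->
  has_degree (k + l) (mwedge D1 D2).
Proof.
move=> d1 d2 p s ds; rewrite /mwedge big1 // => m _.
have sm : size (val m) = size s by rewrite size_tuple.
have snm : size (map negb m) = size s by rewrite size_map size_tuple.
have [e1|ne1] := eqVneq (size (mask m s)) k; last by rewrite d1 // mulr0 mul0r.
rewrite (d2 _ (mask (map negb m) s)) ?mulr0 //; apply: contra ds => /eqP e2.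
rewrite -e1 -e2 !size_mask // count_map.
have -> : count (preim negb id) m = count (predC id) m by exact: eq_count.
by rewrite -[X in X == _]sm; apply/eqP; rewrite -[LHS](count_predC id).
Qed.

Ltac mwedge_eval :=
  rewrite /mwedge /= !sum_tupleS !sum_tuple0 !shuffle_invS !shuffle_inv0 /=
    ?(mul0n, mul1n, addn0, add0n, addn1, addn2, expr0, expr1, sqrr_sign, expr2).

Lemma mwedge0 f D p (s : seq (dual_fibre A p)) :
  mwedge (mfun f) D s = f p * D p s.
Proof.
rewrite /mwedge (bigD1 (nseq_tuple (size s) false)) //= big1 ?addr0.
  rewrite mask_false map_nseq mask_true // /shuffle_inv big1 ?expr0 ?mul1r //.
  move=> i _; apply: big1 => j _.
  by rewrite [tnth _ j](tnth_nth false) /= nth_nseq if_same andbF.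
move=> m m_true; rewrite (_ : mfun f (mask m s) = 0) ?mulr0 ?mul0r //.
suff : size (mask m s) != 0 by case: (mask m s).
rewrite size_mask ?size_tuple // -lt0n -has_count; apply: contraR m_true.
rewrite -all_predC (@eq_all _ _ (pred1 false)); last by case.
by move=> /all_pred1P m_false; apply/eqP/val_inj; rewrite /= m_false size_tuple.
Qed.

(** If the degree of [D1] is known, only the masks of that size contribute. *)
Lemma mwedge11 D1 D2 p (x y : dual_fibre A p) : has_degree 1 D1 ->
  mwedge D1 D2 [:: x; y] =
    D1 p [:: x] * D2 p [:: y] - D1 p [:: y] * D2 p [:: x].
Proof.
move=> d1; mwedge_eval.
rewrite (d1 _ [:: x; y]) // (d1 _ [::]) //; ring.
Qed.

Lemma mwedge21 D1 D2 p (x y z : dual_fibre A p) : has_degree 2 D1 ->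
  mwedge D1 D2 [:: x; y; z] =
    D1 p [:: x; y] * D2 p [:: z] - D1 p [:: x; z] * D2 p [:: y]
    + D1 p [:: y; z] * D2 p [:: x].
Proof.
move=> d1; mwedge_eval.
rewrite (d1 _ [:: x; y; z]) // (d1 _ [::]) // !(d1 _ [:: _]) //; ring.
Qed.

Lemma mwedge12 D1 D2 p (x y z : dual_fibre A p) : has_degree 1 D1 ->
  mwedge D1 D2 [:: x; y; z] =
    D1 p [:: x] * D2 p [:: y; z] - D1 p [:: y] * D2 p [:: x; z]
    + D1 p [:: z] * D2 p [:: x; y].
Proof.
move=> d1; mwedge_eval.
rewrite (d1 _ [:: x; y; z]) // (d1 _ [::]) // !(d1 _ [:: _; _]) //; ring.
Qed.

End LowDegreeWedges.

Section Multisections.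
Context {R : realType} {n : nat} {M : manifold R n} {A : vector_bundle M}.
Implicit Types (f g : M -> R) (X Y Z : vfield A) (D : mfield A).
Implicit Types (alpha beta : cofield A).

Lemma mfield_ext D1 D2 : (forall p s, D1 p s = D2 p s) -> D1 = D2.
Proof.
by move=> D12; apply/functional_extensionality_dep => p; apply/funext => s.
Qed.

Lemma multisection_null k : multisection k (@mnull R n M A).
Proof.
split=> //; first by move=> p s1 s2 a xi eta; rewrite mulr0 addr0.
by move=> i js; exact: smooth_on_cst.
Qed.

Lemma multisection_lin k f D1 D2 : smooth f ->
  multisection k D1 -> multisection k D2 ->
  multisection k (fun p s => f p * D1 p s + D2 p s).
Proof.
move=> fs [d1 l1 a1 s1] [d2 l2 a2 s2]; split.
- by move=> p s sk; rewrite d1 // d2 // mulr0 addr0.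
- by move=> p t1 t2 a xi eta; rewrite l1 l2; ring.
- by move=> p s su; rewrite a1 // a2 // mulr0 addr0.
move=> i js; have iop : open (tdom i) by exact: tdom_open.
exact: (smooth_onD iop (smooth_onM iop (smooth_in fs) (s1 i js)) (s2 i js)).
Qed.

Lemma multisection_fun f : smooth f -> multisection 0 (@Defs.mfun R n M A f).
Proof.
move=> fs; split.
- by move=> p [].
- by move=> p [|x s1] s2 a xi eta /=; rewrite mulr0 addr0.
- by move=> p [].
by move=> i [|j js] /=; [exact: smooth_in|exact: smooth_on_cst].
Qed.

Lemma multisection_vec X : smooth_section X -> multisection 1 (mvec X).
Proof.
move=> Xs; split.
- by move=> p [|x []].
- move=> p [|x [|y s1]] [|z s2] a xi eta /=; rewrite ?mulr0 ?addr0 //.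
  by rewrite add_lfunE scale_lfunE.
- by move=> p [|x []].
move=> i [|j [|k js]] /=; try exact: smooth_on_cst.
by apply: smooth_on_eq (Xs i j) => [|p _]; [exact: tdom_open|rewrite coframeE].
Qed.

Lemma degree_vec X : has_degree 1 (mvec X).
Proof. by move=> p [|? []]. Qed.

Lemma mwedge_vec Y Z p (x y : dual_fibre A p) :
  mwedge (mvec Y) (mvec Z) [:: x; y] = x (Y p) * y (Z p) - y (Y p) * x (Z p).
Proof. exact: mwedge11 (degree_vec Y). Qed.

Lemma multisection_wedge_vec Y Z : smooth_section Y -> smooth_section Z ->
  multisection 2 (mwedge (mvec Y) (mvec Z)).
Proof.
move=> Ys Zs; have deg := mwedge_degree (degree_vec Y) (degree_vec Z).
split=> //.
- move=> p s1 s2 a xi eta.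
  have [s12|s12] := eqVneq (size (s1 ++ xi :: s2)) 2%N; last first.
    rewrite !deg ?mulr0 ?addr0 //; by move: s12; rewrite !size_cat.
  case: s1 s12 => [|x [|x' s1]]; case: s2 => [|y [|y' s2]] //=.
  + by move=> _; rewrite !mwedge_vec !add_lfunE !scale_lfunE /GRing.scale /=; ring.
  + by move=> _; rewrite !mwedge_vec !add_lfunE !scale_lfunE /GRing.scale /=; ring.
  + by case: s1.
  + by case: s1.
  + by case: s1.
- move=> p s s_nuniq; have [s2|s2] := eqVneq (size s) 2%N; last exact: deg.
  case: s s2 s_nuniq => [|x [|y []]] //= _.
  by rewrite inE andbT negbK => /eqP ->; rewrite mwedge_vec; ring.
move=> i js; have iop : open (tdom i) by exact: tdom_open.
have [js2|js2] := eqVneq (size js) 2%N; last first.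
  apply: smooth_on_eq (smooth_on_cst _ 0) => // p _.
  by rewrite deg // size_map.
case: js js2 => [|j [|k []]] //= _.
apply: (smooth_on_eq iop _ (smooth_onD iop (smooth_onM iop (Ys i j) (Zs i k))
  (smooth_onM iop (smooth_on_cst _ (-1)) (smooth_onM iop (Ys i k) (Zs i j))))).
by move=> p _; rewrite mwedge_vec !coframeE; ring.
Qed.

(** ** Bivectors *)

Definition sharp_map D : comap := fun p xi => @sharp R n M A D p xi.

Lemma bivector_skew D p (x y : dual_fibre A p) : multisection 2 D ->
  D p [:: x; y] = - D p [:: y; x].
Proof.
case=> _ lin alt _.
have alt2 z : D p [:: z; z] = 0 by apply: alt; rewrite /= inE eqxx.
have := alt2 (1 *: x + y); rewrite (lin p [::]) (lin p [:: x] [::]).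
by rewrite (lin p [:: y] [::]) /= !alt2; lra.
Qed.

Lemma sharp_skew_comap D : multisection 2 D -> skew_comap (sharp_map D).
Proof.
move=> Dm; split=> [alpha als i k|p xi eta]; last first.
  by rewrite /sharp_map !sharpE // (bivector_skew xi eta Dm).
have iop : open (tdom i) by exact: tdom_open.
have [_ lin _ Ds] := Dm.
apply: (smooth_on_eq iop _ (smooth_on_sum iop (fun j =>
  smooth_onM iop (als i j) (Ds i [:: j; k])))) => p ip /=.
rewrite -coframeE /comap_app /sharp_map sharpE //.
have lin_l (r : seq 'I_(rank A)) :
    D p [:: \sum_(j <- r) alpha p (tnth (frame i p) j) *: coframe i p j; coframe i p k]
    = \sum_(j <- r) alpha p (tnth (frame i p) j) * D p [:: coframe i p j; coframe i p k].
  elim: r => [|j r IH]; last by rewrite !big_cons (lin p [::]) /= IH.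
  rewrite !big_nil; have := lin p [::] [:: coframe i p k] (-1) 0 0.
  by rewrite /= scaler0 addr0; lra.
rewrite -lin_l; congr (D p [:: _; _]); apply/lfunP => v.
rewrite [in RHS](frame_expand v ip) sum_lfunE linear_sum.
apply: eq_bigr => j _; rewrite scale_lfunE coframeE linearZ /GRing.scale /=.
exact: mulrC.
Qed.

Lemma bivector_ext D1 D2 : multisection 2 D1 -> multisection 2 D2 ->
  (forall p xi, sharp_map D1 xi = sharp_map D2 xi :> A p) -> D1 = D2.
Proof.
move=> m1 m2 D12; apply: mfield_ext => p s.
have [s2|s2] := eqVneq (size s) 2%N; last first.
  by rewrite (multisection_degree m1) // (multisection_degree m2).
case: s s2 => [|x [|y []]] //= _.
by rewrite -!sharpE //; congr (_ _); exact: D12.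
Qed.

(** Contracting the decomposition [\sum_j eps_j (x) X_j] of the identity with a
bivector [P] gives [P = 1/2 \sum_j X_j /\ P (eps_j)]. *)
Lemma bivector_decomposition D q : multisection 2 D ->
  exists m (Y Z : 'I_m -> vfield A),
    [/\ forall j, smooth_section (Y j), forall j, smooth_section (Z j) &
        comap_decomposes q (sharp_map D) (fun j => wedge_comap (Y j) (Z j))].
Proof.
move=> Dm; have Ds := sharp_skew_comap Dm.
have [m [X [eps [f1 [f2 [Xs es [f1s f2s] [f10 f20] XE]]]]]] :=
  @local_frame R n M A q.
exists m, (fun j p => 2^-1 *: X j p), (fun j => comap_app (sharp_map D) (eps j)).
split=> [j|j|]; first by apply: sectionZ (Xs j); exact: smooth_cst.
  exact: comap_app_smooth.
exists f1, f2; split=> // p xi; apply: covector_separated => eta.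
rewrite linear_sum.
transitivity (2^-1 * (xi (\sum_j eps j p (sharp_map D eta) *: X j p) * -1
                    + eta (\sum_j eps j p (sharp_map D xi) *: X j p))).
  rewrite !linear_sum mulrDr mulr_suml !mulr_sumr -big_split /=.
  apply: eq_bigr => j _; rewrite /wedge_comap linearB !linearZ /= /comap_app.
  rewrite (comap_skew Ds _ eta) (comap_skew Ds _ xi) /GRing.scale /=; ring.
rewrite !XE !linearZ /= (comap_skew Ds eta xi) /GRing.scale /=.
lra.
Qed.

Lemma mwedge_decomposition D q m (Y Z : 'I_m -> vfield A) :
  multisection 2 D ->
  comap_decomposes q (sharp_map D) (fun j => wedge_comap (Y j) (Z j)) ->
  exists f1 f2, [/\ smooth f1, smooth f2, f1 q = 0, f2 q = 0 &
    (fun p s => (1 - f1 p * f2 p) * D p s) =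
    (fun p s => \sum_j mwedge (mvec (Y j)) (mvec (Z j)) s) :> mfield A].
Proof.
move=> Dm [f1 [f2 [f1s f2s f10 f20 DE]]]; exists f1, f2; split=> //.
apply: mfield_ext => p s.
have [s2|s2] := eqVneq (size s) 2%N; last first.
  rewrite (multisection_degree Dm) // mulr0 big1 // => j _.
  by rewrite (mwedge_degree (degree_vec _) (degree_vec _)).
case: s s2 => [|x [|y []]] //= _.
rewrite -sharpE //.
transitivity (y ((1 - f1 p * f2 p) *: sharp_map D x)); first by rewrite [RHS]linearZ.
rewrite -DE linear_sum; apply: eq_bigr => j _.
by rewrite mwedge_vec /wedge_comap linearB !linearZ /= /GRing.scale /=; ring.
Qed.

End Multisections.

(** * Untwisting a Hom-Lie algebroid *)

Section Untwisting.
Context {R : realType} {n : nat} {M : manifold R n} {A : vector_bundle M}.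
Context (H : hom_lie_algebroid A).
Implicit Types (f g : M -> R) (X Y Z : vfield A) (D : mfield A).
Implicit Types (alpha beta gamma : cofield A) (N : endofield A).
Local Notation phi := (bphi H).
Local Notation phi_inv := (bphi_inv H).

Lemma section_through q (v : A q) : exists2 X, smooth_section X & X q = v.
Proof.
have [m [X [eps [f1 [f2 [Xs es [f1s f2s] [f10 f20] XE]]]]]] :=
  @local_frame R n M A q.
exists (fun p => \sum_j (fun=> eps j q v) p *: X j p).
  by apply: section_sum => j; apply: sectionZ (Xs j); exact: smooth_cst.
by rewrite XE f10 mul0r subr0 scale1r.
Qed.

Lemma cosection_through q (xi : dual_fibre A q) :
  exists2 alpha, smooth_cosection alpha & alpha q = xi.
Proof.
have [m [X [eps [f1 [f2 [Xs es [f1s f2s] [f10 f20] XE]]]]]] :=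
  @local_frame R n M A q.
exists (fun p => \sum_j xi (X j q) *: eps j p); first exact: cosection_sum.
apply/lfunP => v; have /(congr1 xi) := XE q v.
rewrite f10 mul0r subr0 scale1r => <-; rewrite sum_lfunE linear_sum.
apply: eq_bigr => j _; rewrite scale_lfunE linearZ /GRing.scale /=.
exact: mulrC.
Qed.

Lemma phiA_sum p m (c : 'I_m -> M -> R) (X : 'I_m -> vfield A) :
  (forall j, smooth (c j)) -> (forall j, smooth_section (X j)) ->
  phiA H (fun q => \sum_j c j q *: X j q) p =
  \sum_j c j (phi p) *: phiA H (X j) p.
Proof.
move=> cs Xs.
suff : phiA H (fun q => \sum_j c j q *: X j q) p =
       \sum_j c j (phi p) *: phiA H (X j) p /\
       smooth_section (fun q => \sum_j c j q *: X j q) by case.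
elim: (index_enum _) => [|j r [IH rs]].
  have -> : (fun q => \sum_(j <- [::]) c j q *: X j q) =
            (fun q => 0 *: (fun q' => 0 : A q') q).
    by apply/functional_extensionality_dep => q; rewrite big_nil scaler0.
  rewrite big_nil (phiA_scale H _ (smooth_cst 0) section0) scale0r; split=> //.
  exact: sectionZ (smooth_cst 0) section0.
have E : (fun q => \sum_(i <- j :: r) c i q *: X i q) =
   (fun q => 1 *: (fun q' => c j q' *: X j q') q + \sum_(i <- r) c i q *: X i q).
  by apply/functional_extensionality_dep => q; rewrite big_cons scale1r.
have cXs : smooth_section (fun q' => c j q' *: X j q') by exact: sectionZ.
rewrite big_cons E (phiA_linear H 1 p cXs rs) phiA_scale // scale1r IH.
by split=> //; exact: section_lin (smooth_cst 1) cXs rs.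
Qed.

(** As [phi_A] is linear over the functions up to [phi^*], it acts fibrewise; it
is onto the fibre at [p] because [phi_A] is onto the sections, and the fibres at
[p] and [phi p] have the same dimension. *)
Lemma phiA_fibrewise p : exists L : 'Hom(A (phi p), A p),
  [/\ forall X, smooth_section X -> phiA H X p = L (X (phi p)),
      injective L & forall w, exists v, L v = w].
Proof.
have [m [X [eps [f1 [f2 [Xs es [f1s f2s] [f10 f20] XE]]]]]] :=
  @local_frame R n M A (phi p).
pose F v := \sum_j eps j (phi p) v *: phiA H (X j) p.
have F_linear : linear F.
  move=> a u v; rewrite /F scaler_sumr -big_split; apply: eq_bigr => j _.
  by rewrite linearP /= scalerDl scalerA.
pose L : 'Hom(A (phi p), A p) :=
  linfun (HB.pack F (GRing.isLinear.Build _ _ _ _ F F_linear) : {linear _ -> _}).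
have LE v : L v = F v by rewrite lfunE.
have phiAE Y : smooth_section Y -> phiA H Y p = L (Y (phi p)).
  move=> Ys; rewrite LE /F.
  rewrite -(@phiA_sum _ _ (fun j => pairing (eps j) Y)) //; last first.
    by move=> j; exact: pairing_smooth.
  have -> : (fun q => \sum_j pairing (eps j) Y q *: X j q) =
            (fun q => (1 + - (f1 q * f2 q)) *: Y q).
    by apply/functional_extensionality_dep => q; exact: XE.
  rewrite phiA_scale //; first by rewrite f10 mul0r subr0 scale1r.
  apply: smoothD; first exact: smooth_cst.
  by apply: smoothN; exact: smoothM.
have L_onto w : exists v, L v = w.
  have [Y Ys <-] := section_through w.
  exists (phiA_inv H Y (phi p)); rewrite -phiAE ?phiA_invK //.
  exact: phiA_inv_section.
exists L; split=> //; apply/lker0P.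
have dim q : \dim (fullv : {vspace A q}) = rank A.
  by have [i iq] := tdom_cover A q; rewrite -(size_basis (frame_basis iq)).
have img : limg L = fullv.
  apply/vspaceP => w; rewrite memvf; have [v <-] := L_onto w.
  by rewrite memv_img ?memvf.
have := limg_ker_dim L fullv; rewrite img capfv !dim.
move=> /eqP; rewrite -[X in _ == X]add0n eqn_add2r dimv_eq0.
by [].
Qed.

(** The Yau untwisting of the bracket and of the anchor. *)
Definition ubr X Y : vfield A := phiA_inv H (bracket H X Y).

Definition urho X f q : R := anchor H (phiA H X (phi_inv q)) f.

Lemma urhoE X f p : urho X f (phi p) = anchor H (phiA H X p) f.
Proof. by rewrite /urho bphiK. Qed.

Lemma ubr_section X Y : smooth_section X -> smooth_section Y ->
  smooth_section (ubr X Y).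
Proof. by move=> Xs Ys; apply: phiA_inv_section; exact: bracket_section. Qed.

Lemma phiA_ubr X Y : smooth_section X -> smooth_section Y ->
  phiA H (ubr X Y) = bracket H X Y.
Proof. by move=> Xs Ys; rewrite phiA_invK //; exact: bracket_section. Qed.

Lemma untwisted_skew_algebroid : skew_algebroid ubr urho.
Proof.
split=> [X Y Xs Ys|X Y q|X Y Z q|X f Y q|f X Y g q|X f g q|X f g q].
- exact: ubr_section.
all: rewrite -(bphi_invK H q); move: (phi_inv q) => {}q.
all: have [L [LE L_inj _]] := phiA_fibrewise q; have us := ubr_section.
- move=> Xs Ys; apply: L_inj; rewrite linearN /= -!LE; try exact: us.
  by rewrite !phiA_ubr // bracket_skew.
- move=> Xs Ys Zs; have YZs := sectionD Ys Zs.
  apply: L_inj; rewrite linearD /= -!LE; try exact: us.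
  rewrite !phiA_ubr // bracket_skew //.
  have -> : (fun p => Y p + Z p) = (fun p => 1 *: Y p + Z p).
    by apply/functional_extensionality_dep => p; rewrite scale1r.
  rewrite bracket_linear // scale1r opprD.
  by rewrite -(bracket_skew H q Xs Ys) -(bracket_skew H q Xs Zs).
- move=> Xs fs Ys; have fYs := sectionZ fs Ys.
  apply: L_inj; rewrite linearD !linearZ /= -!LE //; try exact: us.
  by rewrite !phiA_ubr // bracket_leibniz // urhoE.
- move=> fs Xs Ys gs; rewrite !urhoE !LE //; last exact: section_lin.
  by rewrite linearP anchor_linear.
- move=> Xs fs gs; rewrite !urhoE.
  have [lin _] := anchor_tangent H (phiA H X q).
  have -> : (fun p => f p + g p) = (fun p => 1 * f p + g p).
    by apply/funext => p; rewrite mul1r.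
  by rewrite lin // mul1r.
move=> Xs fs gs; rewrite !urhoE.
by have [_ ->] := anchor_tangent H (phiA H X q).
Qed.

(** ** Covectors *)

(** On sections, [xi] is then the value at [p] of the image of [alpha] under the
extension of [phi_A] to the dual bundle. *)
Definition pulled_back p (xi : dual_fibre A p) alpha : Prop :=
  forall X, smooth_section X -> xi (phiA H X p) = alpha (phi p) (X (phi p)).

Lemma pull_covector p (xi : dual_fibre A p) :
  exists2 alpha, smooth_cosection alpha & pulled_back xi alpha.
Proof.
have [L [LE _ _]] := phiA_fibrewise p.
have [alpha als alphaE] := cosection_through (xi \o L)%VF.
exists alpha => // X Xs.
by rewrite alphaE comp_lfunE LE.
Qed.

Lemma push_covector p alpha : exists xi : dual_fibre A p, pulled_back xi alpha.
Proof.
have [L [LE L_inj _]] := phiA_fibrewise p.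
exists (alpha (phi p) \o L^-1)%VF => X Xs.
by rewrite comp_lfunE LE // lker0_lfunK //; exact/lker0P.
Qed.

(** ** Nijenhuis operators *)

Local Notation torsion_free := (@torsion_free R n M A ubr).
Local Notation mixed_torsion := (@mixed_torsion R n M A ubr).
Local Notation concomitant_free := (@concomitant_free R n M A ubr urho).
Local Notation cobr := (@cobr R n M A ubr urho).

Definition phi_invariant N : Prop := forall X, smooth_section X ->
  phiA H (endo_app N X) = endo_app N (phiA H X).

(** At [p] the decomposition of [N] at [phi p] provided by [local_frame] gives
the left-to-right implication; conversely any decomposition can be used because
[phi_A] acts fibrewise. *)
Lemma phi_endoP N : bundle_endo N -> phi_endo H N N <-> phi_invariant N.
Proof.
move=> Ns; split=> [Nphi X Xs|Nphi p m xi X xis Xs NE Y Ys].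
  apply/functional_extensionality_dep => p.
  have [L [LE _ _]] := phiA_fibrewise p.
  have [m [Y [eps [f1 [f2 [Ys es [f1s f2s] [f10 f20] YE]]]]]] :=
    @local_frame R n M A (phi p).
  have NYs j : smooth_section (endo_app N (Y j)) by exact: endo_app_smooth.
  have NE v : N (phi p) v = \sum_j eps j (phi p) v *: endo_app N (Y j) (phi p).
    have /(congr1 (N (phi p))) := YE (phi p) v.
    rewrite f10 mul0r subr0 scale1r => <-; rewrite linear_sum.
    by apply: eq_bigr => j _; rewrite linearZ.
  rewrite [RHS](Nphi p m eps _ es NYs NE _ (phiA_section H Xs)).
  rewrite LE; last exact: endo_app_smooth.
  rewrite [endo_app N X _]NE linear_sum; apply: eq_bigr => j _.
  by rewrite linearZ /= /phi_dag /= phiAK // (LE _ (NYs j)).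
have [L [LE _ _]] := phiA_fibrewise p.
have Y's := phiA_inv_section H Ys.
have <- : phiA H (endo_app N (phiA_inv H Y)) p = N p (Y p).
  by rewrite Nphi // /endo_app phiA_invK.
rewrite LE; last exact: endo_app_smooth.
rewrite [endo_app N _ _]NE linear_sum; apply: eq_bigr => j _.
by rewrite linearZ (LE _ (Xs j)).
Qed.

Lemma phi_invariant_pow N k : bundle_endo N -> phi_invariant N ->
  phi_invariant (endo_pow N k).
Proof.
move=> Ns Nphi; elim: k => [|k IH] X Xs; first by rewrite !endo_app_pow0.
rewrite !endo_app_powS Nphi ?IH //; apply: endo_app_smooth => //.
exact: endo_pow_bundle.
Qed.

Lemma torsionE N X Y p (L : 'Hom(A (phi p), A p)) :
  bundle_endo N -> phi_invariant N ->
  (forall X, smooth_section X -> phiA H X p = L (X (phi p))) ->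
  smooth_section X -> smooth_section Y ->
  torsion H N X Y p = L (mixed_torsion N N X Y (phi p)).
Proof.
move=> Ns Nphi LE Xs Ys.
have NXs : smooth_section (endo_app N X) by exact: endo_app_smooth.
have NYs : smooth_section (endo_app N Y) by exact: endo_app_smooth.
have NL v : N p (L v) = L (N (phi p) v).
  have [Z Zs <-] := section_through v; rewrite -LE //.
  have /(congr1 (fun W : vfield A => W p)) := Nphi Z Zs.
  by rewrite {2}/endo_app => <-; rewrite LE //; exact: endo_app_smooth.
have brE Z W : smooth_section Z -> smooth_section W ->
    bracket H Z W p = L (ubr Z W (phi p)).
  by move=> Zs Ws; rewrite -phiA_ubr // LE //; exact: ubr_section.
rewrite /torsion /mixed_torsion !endo_powS id_lfunE !brE // !NL.
by rewrite !(linearB, linearD).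
Qed.

Lemma nijenhuisP N : hom_nijenhuis H N <->
  [/\ bundle_endo N, torsion_free N N & phi_invariant N].
Proof.
split=> [[Ns TN /(phi_endoP Ns) Nphi]|[Ns TN Nphi]]; split=> //.
- move=> X Y q; rewrite -(bphi_invK H q); move: (phi_inv q) => {}q Xs Ys.
  have [L [LE L_inj _]] := phiA_fibrewise q.
  by apply: L_inj; rewrite -torsionE // TN // linear0.
- move=> X Y p Xs Ys; have [L [LE _ _]] := phiA_fibrewise p.
  by rewrite (torsionE Ns Nphi LE) // TN // linear0.
- exact/phi_endoP.
Qed.

(** ** Compatible pairs *)

Lemma cobracketE (P : comap) alpha beta Y p : smooth_section Y ->
  cobracket H P alpha beta (phiA H Y) p = cobr P alpha beta Y (phi p).
Proof.
move=> Ys; rewrite /cobracket /cobr /lie /dA /act !urhoE phiAK //.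
Qed.

Lemma compatibleP D N : bundle_endo N -> phi_invariant N ->
  compatible H D N <->
  commuting (sharp_map D) N /\ concomitant_free (sharp_map D) N.
Proof.
move=> Ns Nphi.
have NE X : smooth_section X -> endo_app N (phiA H X) = phiA H (endo_app N X).
  by move=> Xs; rewrite Nphi.
have postE alpha beta Y p : smooth_section Y ->
    cobracket H (fun q xi => N q (sharp D xi)) alpha beta (phiA H Y) p =
    cobr (post N (sharp_map D)) alpha beta Y (phi p).
  by move=> Ys; rewrite -cobracketE.
have sharpE' alpha beta Y p : smooth_section Y ->
    cobracket H (fun q => @sharp R n M A D q) alpha beta (phiA H Y) p =
    cobr (sharp_map D) alpha beta Y (phi p).
  by move=> Ys; rewrite -cobracketE.
split=> -[c C]; split=> //.
  move=> alpha beta Y q; rewrite -(bphi_invK H q); move: (phi_inv q) => {}q.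
  move=> als bs Ys; have := C alpha beta _ q als bs (phiA_section H Ys).
  have NYs := endo_app_smooth Ns Ys.
  by rewrite NE // postE // !sharpE' // concomitantE // => ->; ring.
move=> alpha beta Y p als bs Ys; rewrite -(phiA_invK H Ys).
have Y's := phiA_inv_section H Ys; move: (phiA_inv H Y) Y's => Z Zs.
have NZs := endo_app_smooth Ns Zs.
have := C alpha beta Z (phi p) als bs Zs.
by rewrite concomitantE // NE // postE // !sharpE' // => h; lra.
Qed.

End Untwisting.

(** * The Hom-Schouten bracket in terms of the untwisted calculus *)

Section Schouten.
Context {R : realType} {n : nat} {M : manifold R n} {A : vector_bundle M}.
Context {H : hom_lie_algebroid A} {Phi : mfield A -> mfield A}.
Arguments Phi : clear implicits.
Context (hPhi : phi_extension H Phi).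
Implicit Types (f g : M -> R) (X Y Z : vfield A) (D P : mfield A).
Implicit Types (alpha beta gamma : cofield A) (N : endofield A).
Local Notation phi := (bphi H).
Local Notation ubr := (ubr H).
Local Notation urho := (urho H).
Local Notation lie_bivector := (@lie_bivector R n M A ubr urho).
Local Notation schouten3 := (@schouten3 R n M A ubr urho).
Local Notation schouten3_free := (@schouten3_free R n M A ubr urho).

Lemma multisection_mul k f D : smooth f -> multisection k D ->
  multisection k (mwedge (mfun f) D).
Proof.
move=> fs Dm; have := multisection_lin fs Dm (multisection_null k).
by congr multisection; apply: mfield_ext => p s; rewrite mwedge0 addr0.
Qed.

Lemma mscale_addE f1 f2 D :
  (fun p s => (1 - f1 p * f2 p) * D p s) =
  madd (mscale (-1) (mwedge (mfun f1) (mwedge (mfun f2) D))) D.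
Proof.
apply: mfield_ext => p s.
by rewrite /madd /mscale !mwedge0; ring.
Qed.

Lemma multisection_sum k m (D : 'I_m -> mfield A) (r : seq 'I_m) :
  (forall j, multisection k (D j)) ->
  multisection k (fun p s => \sum_(j <- r) D j p s).
Proof.
move=> Ds; elim: r => [|j r IH].
  have := multisection_null (A := A) k; congr multisection.
  by apply: mfield_ext => p s; rewrite big_nil.
have := multisection_lin (smooth_cst 1) (Ds j) IH; congr multisection.
by apply: mfield_ext => p s; rewrite big_cons mul1r.
Qed.

Lemma additive_sum k m (F : mfield A -> mfield A) (D : 'I_m -> mfield A) :
  (forall a D1 D2, multisection k D1 -> multisection k D2 ->
     F (madd (mscale a D1) D2) = madd (mscale a (F D1)) (F D2)) ->
  (forall j, multisection k (D j)) ->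
  forall p s, F (fun p s => \sum_j D j p s) p s = \sum_j F (D j) p s.
Proof.
move=> F_lin Ds p s; elim: (index_enum _) => [|j r IH].
  rewrite big_nil; have z := multisection_null (A := A) k.
  have := F_lin (-1) _ _ z z.
  have E : (fun p s => \sum_(j <- [::]) D j p s) = mnull (A := A).
    by apply: mfield_ext => q t; rewrite big_nil.
  have -> : madd (mscale (-1) (mnull (A := A))) (mnull (A := A)) = mnull (A := A).
    by apply: mfield_ext => q t; rewrite /madd /mscale mulr0 addr0.
  rewrite E => /(congr1 (fun D => D p s)) ->.
  by rewrite /madd /mscale mulN1r addNr.
have -> : (fun p s => \sum_(i <- j :: r) D i p s) =
   madd (mscale 1 (D j)) (fun p s => \sum_(i <- r) D i p s).
  by apply: mfield_ext => q t; rewrite big_cons /madd /mscale mul1r.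
rewrite F_lin //; last exact: multisection_sum.
by rewrite big_cons /madd /mscale mul1r IH.
Qed.

Lemma Phi_mul f D k : smooth f -> multisection k D ->
  Phi (mwedge (mfun f) D) = mwedge (mfun (f \o phi)) (Phi D).
Proof.
move=> fs Dm.
by rewrite (phi_ext_wedge hPhi (multisection_fun fs) Dm) (phi_ext_fun hPhi).
Qed.

Lemma Phi_vec_wedge Y Z p (x y : dual_fibre A p) alpha beta :
  smooth_section Y -> smooth_section Z ->
  pulled_back H x alpha -> pulled_back H y beta ->
  Phi (mwedge (mvec Y) (mvec Z)) p [:: x; y] =
    alpha (phi p) (Y (phi p)) * beta (phi p) (Z (phi p))
    - beta (phi p) (Y (phi p)) * alpha (phi p) (Z (phi p)).
Proof.
move=> Ys Zs xa yb.
rewrite (phi_ext_wedge hPhi (multisection_vec Ys) (multisection_vec Zs)).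
by rewrite !(phi_ext_vec hPhi) // mwedge_vec !xa // !yb.
Qed.

Lemma Phi_jet f1 f2 D k p s : smooth f1 -> smooth f2 -> multisection k D ->
  f1 (phi p) = 0 -> f2 (phi p) = 0 ->
  Phi (fun p s => (1 - f1 p * f2 p) * D p s) p s = Phi D p s.
Proof.
move=> f1s f2s Dm f10 f20; have f2D := multisection_mul f2s Dm.
rewrite mscale_addE (phi_ext_linear hPhi _ (multisection_mul f1s f2D) Dm).
by rewrite (Phi_mul f1s f2D) /madd /mscale mwedge0 /= f10 mul0r mulr0 add0r.
Qed.

Lemma Phi_bivector D p (x y : dual_fibre A p) alpha beta : multisection 2 D ->
  pulled_back H x alpha -> pulled_back H y beta ->
  Phi D p [:: x; y] = D (phi p) [:: alpha (phi p); beta (phi p)].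
Proof.
move=> Dm xa yb.
have [m [Y [Z [Ys Zs YZ]]]] := bivector_decomposition (phi p) Dm.
have [f1 [f2 [f1s f2s f10 f20 DE]]] := mwedge_decomposition Dm YZ.
rewrite -(Phi_jet _ f1s f2s Dm f10 f20) DE.
have wm j := multisection_wedge_vec (Ys j) (Zs j).
rewrite (additive_sum (fun a D1 D2 =>
  phi_ext_linear hPhi (k := 2) a (D1 := D1) (D2 := D2)) wm).
transitivity ((1 - f1 (phi p) * f2 (phi p)) *
  D (phi p) [:: alpha (phi p); beta (phi p)]); last by rewrite f10 mul0r subr0 mul1r.
have /(congr1 (fun E : mfield A => E (phi p) [:: alpha (phi p); beta (phi p)])) := DE.
move=> /= ->; apply: eq_bigr => j _.
by rewrite mwedge_vec (Phi_vec_wedge (Ys j) (Zs j) xa yb).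
Qed.

Context {Sch : mfield A -> mfield A -> mfield A}.
Arguments Sch : clear implicits.
Context (hS : hom_schouten H Phi Sch).

(** By the Leibniz rule, applied twice, each term of the bracket with
[f1 f2 P] contains the value at [phi p] of [f1] or of [f2]. *)
Lemma schouten_jet k l f1 f2 D P p s :
  smooth f1 -> smooth f2 -> multisection k D -> multisection l P ->
  f1 (phi p) = 0 -> f2 (phi p) = 0 ->
  Sch D (fun p s => (1 - f1 p * f2 p) * P p s) p s = Sch D P p s.
Proof.
move=> f1s f2s Dm Pm f10 f20; have f2P := multisection_mul f2s Pm.
have f12P := multisection_mul f1s f2P.
rewrite mscale_addE (schouten_linearr hS _ Dm f12P Pm).
rewrite (schouten_leibniz hS Dm (multisection_fun f1s) f2P).
rewrite (Phi_mul f2s Pm) (phi_ext_fun hPhi f1s) /madd /mscale mwedge0 /= f10.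
have -> : mwedge (Sch D (mfun f1)) (mwedge (mfun (f2 \o phi)) (Phi P)) s = 0.
  rewrite {1}/mwedge big1 // => t _.
  by rewrite mwedge0 /= f20 mul0r mulr0.
by rewrite mul0r mulr0 addr0 mulr0 add0r.
Qed.

(** Both sides are additive and of first order in [P], which reduces the claim to
products of two sections. *)
Lemma schouten_vec_bivector Y P p (x y : dual_fibre A p) alpha beta :
  smooth_section Y -> multisection 2 P ->
  smooth_cosection alpha -> smooth_cosection beta ->
  pulled_back H x alpha -> pulled_back H y beta ->
  Sch (mvec Y) P p [:: x; y] =
    lie_bivector (sharp_map P) Y alpha beta (phi p).
Proof.
move=> Ys Pm als bs xa yb; have Ym := multisection_vec Ys.
have [m [Z [W [Zs Ws ZW]]]] := bivector_decomposition (phi p) Pm.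
have [f1 [f2 [f1s f2s f10 f20 PE]]] := mwedge_decomposition Pm ZW.
have wm j := multisection_wedge_vec (Zs j) (Ws j).
rewrite -(schouten_jet _ f1s f2s Ym Pm f10 f20) PE.
rewrite (additive_sum (fun a D1 D2 =>
  schouten_linearr hS (l := 2) a (D2 := D1) (D2' := D2) Ym) wm).
have Ps := comap_app_smooth (sharp_skew_comap Pm).
have alg := untwisted_skew_algebroid H.
rewrite (lie_bivector_local alg Ys als bs Ps _ ZW); last first.
  by move=> j gamma gs; exact: wedge_comap_smooth.
apply: eq_bigr => j _; rewrite (lie_bivector_wedge alg) //.
rewrite (schouten_leibniz hS Ym (multisection_vec (Zs j)) (multisection_vec (Ws j))).
rewrite !(schouten_vec hS) // !(phi_ext_vec hPhi) // /madd /mscale !mwedge_vec.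
rewrite -!phiA_ubr // !xa ?yb //; try exact: ubr_section.
ring.
Qed.

(** Reduced to the case that [Q] is a product [Y /\ Z], where the Leibniz rule of
the bracket matches [schouten3_wedge]. *)
Lemma schouten_bivector P Q p (x y z : dual_fibre A p) alpha beta gamma :
  multisection 2 P -> multisection 2 Q ->
  smooth_cosection alpha -> smooth_cosection beta -> smooth_cosection gamma ->
  pulled_back H x alpha -> pulled_back H y beta -> pulled_back H z gamma ->
  Sch P Q p [:: x; y; z] =
    schouten3 (sharp_map P) (sharp_map Q) alpha beta gamma (phi p).
Proof.
move=> Pm Qm als bs gs xa yb zc.
have [m [Y [Z [Ys Zs YZ]]]] := bivector_decomposition (phi p) Qm.
have [f1 [f2 [f1s f2s f10 f20 QE]]] := mwedge_decomposition Qm YZ.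
have wm j := multisection_wedge_vec (Ys j) (Zs j).
rewrite -(schouten_jet _ f1s f2s Pm Qm f10 f20) QE.
rewrite (additive_sum (fun a D1 D2 =>
  schouten_linearr hS (l := 2) a (D2 := D1) (D2' := D2) Pm) wm).
have Qs := comap_app_smooth (sharp_skew_comap Qm).
have Ps := sharp_skew_comap Pm.
have alg := untwisted_skew_algebroid H.
rewrite (schouten3_local alg Ps als bs gs Qs _ YZ); last first.
  by move=> j delta ds; exact: wedge_comap_smooth.
apply: eq_bigr => j _; rewrite (schouten3_wedge alg) //.
have Ym := multisection_vec (Ys j); have Zm := multisection_vec (Zs j).
rewrite (schouten_leibniz hS Pm Ym Zm) /madd /mscale.
rewrite !(phi_ext_vec hPhi) // mwedge21; last first.
  exact: multisection_degree (schouten_multisection hS Pm Ym).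
rewrite mwedge12; last exact: degree_vec.
rewrite (schouten_skew hS Pm Ym) (schouten_skew hS Pm Zm) /mscale /=.
rewrite !(schouten_vec_bivector (Ys j) Pm _ _ xa yb) //.
rewrite !(schouten_vec_bivector (Ys j) Pm _ _ xa zc) //.
rewrite !(schouten_vec_bivector (Ys j) Pm _ _ yb zc) //.
rewrite !(schouten_vec_bivector (Zs j) Pm _ _ xa yb) //.
rewrite !(schouten_vec_bivector (Zs j) Pm _ _ xa zc) //.
rewrite !(schouten_vec_bivector (Zs j) Pm _ _ yb zc) //.
rewrite !xa // !yb // !zc //.
ring.
Qed.

Lemma schouten_bivectorP P Q : multisection 2 P -> multisection 2 Q ->
  Sch P Q = mnull (A := A) <-> schouten3_free (sharp_map P) (sharp_map Q).
Proof.
move=> Pm Qm; split=> [PQ0 alpha beta gamma q|PQ].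
  rewrite -(bphi_invK H q); move: (bphi_inv H q) => {}q als bs gs.
  have [x xa] := push_covector H q alpha.
  have [y yb] := push_covector H q beta.
  have [z zc] := push_covector H q gamma.
  by rewrite -(schouten_bivector Pm Qm als bs gs xa yb zc) PQ0.
apply: mfield_ext => p s.
have [s3|s3] := eqVneq (size s) 3%N; last first.
  by rewrite (multisection_degree (schouten_multisection hS Pm Qm)).
case: s s3 => [|x [|y [|z []]]] //= _.
have [alpha als xa] := pull_covector H x.
have [beta bs yb] := pull_covector H y.
have [gamma gs zc] := pull_covector H z.
by rewrite (schouten_bivector Pm Qm als bs gs xa yb zc) PQ.
Qed.

Lemma Phi_bivectorP P : multisection 2 P ->
  Phi P = P <-> forall p (x : dual_fibre A p) alpha,
    smooth_cosection alpha -> pulled_back H x alpha ->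
    sharp_map P x = phiA H (comap_app (sharp_map P) alpha) p.
Proof.
move=> Pm; have Ps := comap_app_smooth (sharp_skew_comap Pm).
split=> [PP p x alpha als xa|PP].
  apply: covector_separated => y; have [beta bs yb] := pull_covector H y.
  rewrite yb; last exact: Ps.
  by rewrite /comap_app /sharp_map !sharpE // -{1}PP (Phi_bivector Pm xa yb).
apply: mfield_ext => p s.
have [s2|s2] := eqVneq (size s) 2%N; last first.
  rewrite (multisection_degree Pm) //.
  by rewrite (multisection_degree (phi_ext_multisection hPhi Pm)).
case: s s2 => [|x [|y []]] //= _.
have [alpha als xa] := pull_covector H x.
have [beta bs yb] := pull_covector H y.
rewrite (Phi_bivector Pm xa yb) -!sharpE //.
have := PP _ _ _ als xa; rewrite /sharp_map => ->.
by rewrite yb //; exact: Ps.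
Qed.

End Schouten.

(** * The hierarchy *)

Section Hierarchy.
Context {R : realType} {n : nat} {M : manifold R n} {A : vector_bundle M}.
Implicit Types (D : mfield A) (N : endofield A) (P : @comap R n M A).

Lemma comap_ext P1 P2 :
  (forall p (xi : dual_fibre A p), P1 p xi = P2 p xi) -> P1 = P2.
Proof.
by move=> P12; apply/functional_extensionality_dep => p; apply/funext => xi.
Qed.

(** [N] commuting with the sharp map of [D] is what makes the composite
skew-symmetric, hence the sharp map of a bivector. *)
Lemma post_bivector N D : bundle_endo N -> multisection 2 D ->
  commuting (sharp_map D) N ->
  exists2 D', multisection 2 D' & sharp_map D' = post N (sharp_map D).
Proof.
move=> Ns Dm c; have Ps := post_skew Ns c (sharp_skew_comap Dm).
pose D' : mfield A := fun p s =>
  if s is [:: xi; eta] then eta (post N (sharp_map D) xi) else 0.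
have D'm : multisection 2 D'.
  split.
  - by move=> p [|x [|y [|z s]]].
  - move=> p [|x [|x' s1]] [|y [|y' s2]] a xi eta; rewrite /= ?mulr0 ?addr0 //.
    + rewrite (comap_skew Ps _ y) (comap_skew Ps xi y) (comap_skew Ps eta y).
      by rewrite add_lfunE scale_lfunE /GRing.scale /=; ring.
    + by rewrite add_lfunE scale_lfunE.
    + by case: s1 => [|? []] /=; rewrite mulr0 addr0.
    + by case: s1 => [|? []] /=; rewrite mulr0 addr0.
    + by case: s1 => [|? []] /=; rewrite mulr0 addr0.
  - move=> p [|x [|y [|z s]]] //=; rewrite inE andbT negbK => /eqP <-.
    by have := comap_skew Ps x x; lra.
  move=> i [|j [|k [|l js]]] /=; try exact: smooth_on_cst.
  have iop : open (tdom i) by exact: tdom_open.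
  have [_ _ _ Ds] := Dm.
  apply: (smooth_on_eq iop _ (smooth_on_sum iop (fun m =>
    smooth_onM iop (Ns i m k) (Ds i [:: j; m])))) => p ip.
  rewrite /post [in RHS](frame_expand (sharp_map D (coframe i p j)) ip).
  rewrite !linear_sum; apply: eq_bigr => m _.
  have -> : coord (frame i p) m (sharp_map D (coframe i p j)) =
            D p [:: coframe i p j; coframe i p m] by rewrite -coframeE -sharpE.
  by rewrite !linearZ /= coframeE mulrC.
exists D' => //; apply: comap_ext => p xi; apply: covector_separated => eta.
exact: sharpE.
Qed.

Lemma commuting_post N P k : commuting P N -> commuting (post (endo_pow N k) P) N.
Proof. by move=> c p xi; rewrite /post -endo_powS endo_powSr c. Qed.

Lemma post_powS N P k :
  post (endo_pow N k.+1) P = post N (post (endo_pow N k) P).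
Proof. by apply: comap_ext => p xi; rewrite /post endo_powS. Qed.

Lemma post_powD N P k l :
  post (endo_pow N (k + l)) P = post (endo_pow N k) (post (endo_pow N l) P).
Proof. by apply: comap_ext => p xi; rewrite /post endo_powD. Qed.

Lemma hierarchy_sharp D N Ds k : pn_hierarchy D N Ds ->
  sharp_map (Ds k) = post (endo_pow N k) (sharp_map D).
Proof.
case=> D0 _ DS; elim: k => [|k IH].
  by apply: comap_ext => p xi; rewrite D0 /post id_lfunE.
by rewrite post_powS -IH; apply: comap_ext => p xi; exact: DS.
Qed.

Lemma hierarchy_exists D N : bundle_endo N -> multisection 2 D ->
  commuting (sharp_map D) N -> exists Ds, pn_hierarchy D N Ds.
Proof.
move=> Ns Dm c.
have /choice[Ds DsP] : forall k, exists D' : mfield A, multisection 2 D' /\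
    sharp_map D' = post (endo_pow N k) (sharp_map D).
  move=> k; have [||D' D'm D'E] := @post_bivector (endo_pow N k) D _ Dm.
  - exact: endo_pow_bundle.
  - exact: commuting_pow.
  by exists D'.
have DsE k : sharp_map (Ds k) = post (endo_pow N k) (sharp_map D) := (DsP k).2.
exists Ds; split=> [|k|k p xi]; first 2 last.
- rewrite -[LHS]/(sharp_map _ xi) -[sharp (Ds k) xi]/(sharp_map _ xi) !DsE.
  by rewrite post_powS.
- apply: bivector_ext (DsP 0%N).1 Dm _ => p xi.
  by rewrite DsE /post id_lfunE.
- exact: (DsP k).1.
Qed.

End Hierarchy.

Theorem theorem3p12 (R : realType) (n : nat) (M : manifold R n)
    (A : vector_bundle M) (H : hom_lie_algebroid A)
    (Phi : mfield A -> mfield A) (hPhi : phi_extension H Phi)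
    (S : mfield A -> mfield A -> mfield A) (hS : hom_schouten H Phi S)
    (pi : mfield A) (N : endofield A)
    (hpiN : hom_poisson_nijenhuis H Phi S pi N) :
  (exists pis : nat -> mfield A, pn_hierarchy pi N pis) /\
  (forall pis : nat -> mfield A, pn_hierarchy pi N pis ->
     (forall k p : nat,
        hom_poisson_nijenhuis H Phi S (pis k) (endo_pow N p)) /\
     (forall k l : nat, S (pis k) (pis l) = mnull (A := A))).
Proof.
case: hpiN => [[Pm SPP PhiP] /nijenhuisP[Ns TN Nphi] /(compatibleP _ Ns Nphi)[c C]].
have PP := (schouten_bivectorP hPhi hS Pm Pm).1 SPP.
have Ps := sharp_skew_comap Pm.
split; first exact: hierarchy_exists.
move=> pis pisH; have [_ pism _] := pisH.
pose pi_ k := post (endo_pow N k) (sharp_map pi).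
have sE k : sharp_map (pis k) = pi_ k := hierarchy_sharp k pisH.
have Nks k := endo_pow_bundle k Ns.
have Nphik k := phi_invariant_pow k Ns Nphi.
have Tk k l := torsion_free_pow k l Ns TN.
have ck k := commuting_pow k c.
have cNk k : commuting (pi_ k) N := commuting_post k c.
have cNkl k l : commuting (pi_ k) (endo_pow N l) := commuting_pow l (cNk k).
have Psk k : skew_comap (pi_ k) := post_skew (Nks k) (ck k) Ps.
have Ck k : concomitant_free (br := ubr H) (rho := urho H) (pi_ k) N.
  elim: k => [|k IH]; first by rewrite -sE; case: pisH => ->.
  rewrite /pi_ post_powS.
  exact: (concomitant_free_post Ns (Psk k) (cNk k) TN IH).
have Ckl k l : concomitant_free (br := ubr H) (rho := urho H) (pi_ k) (endo_pow N l).
  exact: concomitant_free_pow.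
have PPk k : schouten3_free (br := ubr H) (rho := urho H) (pi_ k) (pi_ k).
  apply: (schouten3_free_post2 (untwisted_skew_algebroid H)) => //.
  exact: concomitant_free_pow.
split=> [k p|].
  split.
  - split=> //.
      by apply/(schouten_bivectorP hPhi hS) => //; rewrite !sE.
    apply/(Phi_bivectorP hPhi) => // q x alpha als xa.
    have := (Phi_bivectorP hPhi Pm).1 PhiP q x alpha als xa.
    rewrite sE /pi_ comap_app_post Nphik; last exact: comap_app_smooth.
    by rewrite {1}/post => ->.
  - by apply/nijenhuisP; split.
  - by apply/compatibleP => //; rewrite sE.
have ordered k l : (k <= l)%N -> S (pis k) (pis l) = mnull (A := A).
  move=> kl; apply/(schouten_bivectorP hPhi hS) => //.
  rewrite !sE -(subnK kl) /pi_ post_powD -/(pi_ k).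
  exact: (schouten3_free_post (untwisted_skew_algebroid H)).
move=> k l; case/orP: (leq_total k l) => [/ordered //|/ordered lk].
rewrite (schouten_skew hS (pism k) (pism l)) lk.
by apply: mfield_ext => p s; rewrite /Defs.mscale mulr0.
Qed.
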